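(* Let $T$ be a set and let $\theta:\mathcal{F}(T)\to[0,\infty)$ be the ECF of a simple max-stable process on $T$. Let $g:[0,\infty)\to[0,\infty)$ be a Bernstein function which is not constant. Then the function $$\mathcal{F}(T)\ni A\mapsto\frac{g(\theta(A))-g(0)}{g(1)-g(0)}$$ is again the ECF of a simple max-stable process on $T$.
   Context: $\mathcal{F}(T)$ is the set of finite subsets of $T$. Simple max-stable process: a process $X=\{X_t\}_{t\in T}$ with $\mathbb{P}(X_t\le x)=e^{-1/x}$ for all $t\in T$, $x>0$, such that for every $n\in\mathbb{N}$ and independent copies $X^{(1)},\dots,X^{(n)}$ of $X$ the process $\{\bigvee_{i=1}^nX^{(i)}_t\}_{t\in T}$ has the same law (finite-dimensional distributions) as $\{nX_t\}_{t\in T}$. Extremal coefficient function (ECF) of a simple max-stable process $X$: $\theta:\mathcal{F}(T)\to[0,\infty)$ with $\theta(\varnothing)=0$ and $\theta(A)=-x\log\mathbb{P}(\bigvee_{t\in A}X_t\le x)$ for non-empty finite $A\subset T$ (independent of $x>0$). Bernstein function: a function $g:[0,\infty)\to[0,\infty)$ satisfying one of the following equivalent conditions: (1) $g(r)=c+br+\int_{(0,\infty)}(1-e^{-\lambda r})\,\nu(\mathrm{d}\lambda)$ with $c,b\ge0$ and $\nu$ a positive Radon measure on $(0,\infty)$ with $\int_{(0,\infty)}\frac{\lambda}{1+\lambda}\nu(\mathrm{d}\lambda)<\infty$; (2) $g$ is continuous, $g\in C^\infty((0,\infty))$, $g\ge0$ and $(-1)^ng^{(n+1)}\ge0$ on $(0,\infty)$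 for all $n\ge0$. *)

(* Defs.v *)
From HB Require Import structures.
From mathcomp Require Import all_boot all_order all_algebra finmap.
From mathcomp Require Import all_classical all_reals all_analysis.

Set Implicit Arguments.
Unset Strict Implicit.
Unset Printing Implicit Defensive.

Import Order.TTheory GRing.Theory Num.Theory.
Import numFieldNormedType.Exports.

Local Open Scope classical_set_scope.
Local Open Scope ring_scope.

(* The measurable structure on [n.-tuple R] is the product Borel
   sigma-algebra, so this is equality of the laws on R^n of all finite-dimensional
   random vectors.  The arguments are plain functions because it is also applied
   to maxima and multiples of processes. *)
Definition same_fdd (R : realType) (T : choiceType)
    (d1 : measure_display) (Omega1 : measurableType d1)
    (P1 : probability Omega1 R) (X : T -> Omega1 -> R)
    (d2 : measure_display) (Omega2 : measurableType d2)
    (P2 : probability Omega2 R) (Y : T -> Omega2 -> R) : Prop :=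
  forall (n : nat) (t : n.-tuple T) (B : set (n.-tuple R)),
    measurable B ->
    P1 [set w | B [tuple X (tnth t i) w | i < n]] =
    P2 [set w | B [tuple Y (tnth t i) w | i < n]].

Definition process_sigma (R : realType) (T : choiceType)
    (d : measure_display) (Omega : measurableType d)
    (X : T -> Omega -> R) : set (set Omega) :=
  <<s \bigcup_t preimage_set_system setT (X t) measurable >>.

(* Since [setT] belongs to every sigma-algebra, the product rule over the whole
   (finite) family contains the product rule over its subfamilies. *)
Definition independent_processes (R : realType) (T : choiceType)
    (d : measure_display) (Omega : measurableType d)
    (P : probability Omega R) (n : nat) (X : 'I_n -> T -> Omega -> R) : Prop :=
  forall E : 'I_n -> set Omega,
    (forall i, process_sigma (X i) (E i)) ->
    P (\bigcap_(i in [set: 'I_n]) E i) = (\prod_(i < n) P (E i))%E.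

(* [n.+1] ranges over the positive integers; the default value
   [X' ord0 t w] of the maximum is one of its terms. *)
Definition simple_max_stable (R : realType) (T : choiceType)
    (d : measure_display) (Omega : measurableType d)
    (P : probability Omega R) (X : T -> {RV P >-> R}) : Prop :=
  (forall (t : T) (x : R), 0 < x ->
     P [set w | X t w <= x] = (expR (- (1 / x)))%:E) /\
  (forall (n : nat) (d' : measure_display) (Omega' : measurableType d')
     (P' : probability Omega' R) (X' : 'I_n.+1 -> T -> {RV P' >-> R}),
     independent_processes P' (fun i t => X' i t : Omega' -> R) ->
     (forall i, same_fdd P' (fun t => X' i t : Omega' -> R)
                         P (fun t => X t : Omega -> R)) ->
     same_fdd
       P' (fun t w => \big[Num.max/X' ord0 t w]_(i < n.+1) X' i t w)
       P (fun t w => n.+1%:R * X t w)).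

(* The logarithm is the extended one, [lne 0 = -oo]: with the real [ln], for
   which [ln 0 = 0], an event of probability 0 would wrongly give
   [theta A = 0].  The maximum is taken in the extended reals, where the neutral
   element [-oo] does not affect it when [A] is non-empty. *)
Definition ecf_of (R : realType) (T : choiceType)
    (d : measure_display) (Omega : measurableType d)
    (P : probability Omega R) (X : T -> {RV P >-> R})
    (theta : {fset T} -> R) : Prop :=
  [/\ forall A, 0 <= theta A,
      theta fset0 = 0 &
      forall A : {fset T}, A <> fset0 -> forall x : R, 0 < x ->
        (theta A)%:E =
        (- (x%:E *
            lne (P [set w | \big[maxe/-oo]_(t <- A) (X t w)%:E <= x%:E])))%E].

Definition is_ecf (R : realType) (T : choiceType)
    (theta : {fset T} -> R) : Prop :=
  exists (d : measure_display) (Omega : measurableType d)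
    (P : probability Omega R) (X : T -> {RV P >-> R}),
    simple_max_stable X /\ ecf_of X theta.

(* Functions [0, oo) -> [0, oo) are functions [R -> R] of which only the values
   on [0, oo) matter.  Likewise [nu] is a Borel measure on R of which only the
   restriction to (0, oo) matters; there, finiteness on compact sets is the
   Radon property, (0, oo) being locally compact with a countable base. *)
Definition bernstein (R : realType) (g : R -> R) : Prop :=
  (forall r, 0 <= r -> 0 <= g r) /\
  exists (c b : R) (nu : {measure set R -> \bar R}),
    [/\ 0 <= c, 0 <= b,
        forall K : set R, compact K -> K `<=` `]0, +oo[ -> (nu K < +oo)%E,
        (\int[nu]_(l in `]0%R, +oo[) (l / (1 + l))%:E < +oo)%E &
        forall r, 0 <= r ->
          (g r)%:E =
          ((c + b * r)%:E +
           \int[nu]_(l in `]0%R, +oo[) (1 - expR (- (l * r)))%:E)%E].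

(* Main.v *)
(** If [X] is simple max-stable with ECF [theta] and
    [g r = c + b r + \int (1 - e^(- l r)) nu(dl)], then
    [1 - e^(- l theta(A)) = P (max_A X > 1/l)], so the integral part of
    [g (theta A)] is the integral of [max_(t in A) 1{l X_t > 1}] against
    [nu \x P].  With [kappa = g 1 - g 0], the process
      [Y_t = max (b/kappa X_t, sup 1{l X_t(omega) > 1} / (kappa s))],
    the supremum being over the points [(l, omega, s)] of an independent Poisson
    process with intensity [nu \x P \x Lebesgue], satisfies
      [P (forall i, Y_(t i) <= x i) =
         P (forall i, b/kappa X_(t i) <= x i) * exp (- L (hit x))],
    where [L] is the intensity and [hit x] the set of the points exceeding some
    level.  As [L (hit (x / n)) = n L (hit x)], [Y] is max-stable, and constant
    levels give its ECF.  The Poisson process needs countably many independent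
    copies of [X], over an arbitrary probability space: this is an infinite
    product of probability measures, obtained by Caratheodory extension from
    the algebra of cylinders.  The same product yields the independent copies
    that turn the max-stability of [X] into an identity between its
    distribution functions. *)
Require Import Defs.
From HB Require Import structures.
From mathcomp Require Import all_boot all_order all_algebra finmap zify ring.
From mathcomp Require Import all_classical all_reals all_analysis measurable_realfun.

Set Implicit Arguments.
Unset Strict Implicit.
Unset Printing Implicit Defensive.

Import Order.TTheory GRing.Theory Num.Theory.
Import numFieldNormedType.Exports.

Local Open Scope classical_set_scope.
Local Open Scope ring_scope.

(** * Infinite products of probability measures *)

(* Two copies of one type: [seqspace] carries the product sigma-algebra,
   [cylspace] the algebra of cylinders on which the content is defined. *)
Definition seqspace (T : Type) : Type := nat -> T.
Definition cylspace (T : Type) : Type := nat -> T.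

(** Opaque copies of the identity, keeping the displays of the two structures apart from each other
    and from that of [T]. *)
Definition seq_display : measure_display -> measure_display.
Proof. exact. Qed.

Definition cyl_display : measure_display -> measure_display.
Proof. exact. Qed.

Section seqspace_measurable.
Context {d} {T : measurableType d}.

Definition seq_sigma : set (set (nat -> T)) :=
  <<s \bigcup_i preimage_set_system setT (fun w : nat -> T => w i) measurable >>.

HB.instance Definition _ := Pointed.on (seqspace T).
HB.instance Definition _ := Pointed.on (cylspace T).

Let seq0 : seq_sigma set0. Proof. exact: sigma_algebra0. Qed.

Let seqC A : seq_sigma A -> seq_sigma (~` A).
Proof. exact: sigma_algebraC. Qed.

Let seq_bigcup (F : (set (nat -> T))^nat) :
  (forall i, seq_sigma (F i)) -> seq_sigma (\bigcup_i F i).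
Proof. exact: sigma_algebra_bigcup. Qed.

HB.instance Definition _ := @isMeasurable.Build (seq_display d)
  (seqspace T) seq_sigma seq0 seqC seq_bigcup.

(** The codomain is arbitrary so that one notion serves for sets, with [U = Prop], and for extended
    real functions. *)
Definition depends_below {U : Type} (n : nat) (f : (nat -> T) -> U) :=
  forall w w', (forall i, (i < n)%N -> w i = w' i) -> f w = f w'.

Definition cylinder : set (set (nat -> T)) :=
  [set A | measurable (A : set (seqspace T)) /\ exists n, depends_below n A].

Lemma depends_below_le {U : Type} m n (f : (nat -> T) -> U) :
  (m <= n)%N -> depends_below m f -> depends_below n f.
Proof. by move=> mn mf w w' ww'; apply: mf => i im; apply/ww'/(leq_trans im). Qed.

Let cyl0 : cylinder set0.
Proof. by split; [exact: measurable0|exists 0%N]. Qed.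

Let cylC : setC_closed cylinder.
Proof.
move=> A [mA [n An]]; split; first exact: measurableC.
by exists n => w w' ww'; rewrite /setC /= (An _ _ ww').
Qed.

Let cylU : setU_closed cylinder.
Proof.
move=> A B [mA [n An]] [mB [m Bm]]; split; first exact: measurableU.
exists (maxn n m) => w w' ww'; congr (_ \/ _).
  exact: (depends_below_le (leq_maxl n m) An).
exact: (depends_below_le (leq_maxr n m) Bm).
Qed.

HB.instance Definition _ := @isAlgebraOfSets.Build (cyl_display d)
  (cylspace T) cylinder cyl0 cylU cylC.

Lemma measurable_coord i : measurable_fun setT (fun w : seqspace T => w i).
Proof.
move=> _ A mA; rewrite setTI; apply: sub_sigma_algebra.
by exists i => //; exists A => //; rewrite setTI.
Qed.

Lemma measurable_seqP d' (U : measurableType d') (f : U -> seqspace T) :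
  (forall i, measurable_fun setT (fun u => f u i)) -> measurable_fun setT f.
Proof.
move=> mf.
apply: (measurability (\bigcup_i preimage_set_system setT
  (fun w : nat -> T => w i) measurable : set (set (seqspace T)))) => //.
move=> _ [_ [i _ [A mA <-]] <-].
by have := mf i measurableT A mA; rewrite !setTI.
Qed.

Lemma cylinder_coord i A : measurable A ->
  cylinder ((fun w : nat -> T => w i) @^-1` A).
Proof.
move=> mA; split.
  by rewrite -[X in measurable X]setTI; exact: measurable_coord.
by exists i.+1 => w w' ww'; rewrite /preimage/= ww'.
Qed.

(** The Caratheodory extension is a measure on the sigma-algebra generated by the cylinders; this
    inclusion carries it over to [seqspace]. *)
Lemma seq_sigma_cylinder (A : set (seqspace T)) : measurable A ->
  <<s cylinder >> A.
Proof.
apply: smallest_sub; first exact: smallest_sigma_algebra.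
move=> _ [i _ [B mB <-]]; apply: sub_sigma_algebra.
by rewrite setTI; exact: cylinder_coord.
Qed.

Definition upd (w : nat -> T) (i : nat) (x : T) : nat -> T :=
  fun j => if j == i then x else w j.

Lemma measurable_upd i :
  measurable_fun setT (fun p : seqspace T * T => upd p.1 i p.2 : seqspace T).
Proof.
apply: measurable_seqP => j; rewrite /upd; case: (j == i).
  exact: measurable_snd.
exact: measurableT_comp (measurable_coord j) measurable_fst.
Qed.

End seqspace_measurable.

(** * Iterated integrals over finitely many coordinates *)

Section iterated_integral.
Context {d} {T : measurableType d} {R : realType}.
Variable P : nat -> probability T R.
Local Open Scope ereal_scope.

Definition ge0mfun (f : seqspace T -> \bar R) :=
  measurable_fun setT f /\ forall w, 0 <= f w.

(* Since coordinates are integrated out in place, functions of finitely many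
   coordinates need no separate finite product space. *)
Definition intcoord i (f : seqspace T -> \bar R) (w : seqspace T) :=
  \int[P i]_x f (upd w i x).

(** Integrates out the coordinates [j, ..., j + k - 1], with [j] outermost, so that peeling off the
    outer integral fixes the coordinates in increasing order. *)
Fixpoint itint j k f := if k is k'.+1 then intcoord j (itint j.+1 k' f) else f.

Lemma measurable_upd2 i w :
  measurable_fun setT (fun x : T => upd w i x : seqspace T).
Proof.
by apply: measurable_seqP => j; rewrite /upd; case: (j == i).
Qed.

Lemma ge0mfun_upd i w f : ge0mfun f ->
  measurable_fun setT (fun x => f (upd w i x)).
Proof. by move=> [mf _]; exact: measurableT_comp mf (measurable_upd2 i w). Qed.

Lemma ge0mfun_intcoord i f : ge0mfun f -> ge0mfun (intcoord i f).
Proof.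
move=> [mf f0]; split; last by move=> w; exact: integral_ge0.
apply: (measurable_fun_fubini_tonelli_F
  (fun p : seqspace T * T => f (upd p.1 i p.2)) _ _) => //.
exact: measurableT_comp mf (measurable_upd i).
Qed.

Lemma ge0mfun_itint j k f : ge0mfun f -> ge0mfun (itint j k f).
Proof.
by move=> mf; elim: k j => //= k IH j; exact/ge0mfun_intcoord/IH.
Qed.

Lemma le_itint j k f g : ge0mfun f -> ge0mfun g -> (forall w, f w <= g w) ->
  forall w, itint j k f w <= itint j k g w.
Proof.
move=> mf mg fg; elim: k j => //= k IH j w.
apply: ge0_le_integral => //; try by
  [move=> x _; apply (ge0mfun_itint _ _ mf).2
  |move=> x _; apply (ge0mfun_itint _ _ mg).2
  |apply/ge0mfun_upd/ge0mfun_itint].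
Qed.

Lemma itintD j k f g : ge0mfun f -> ge0mfun g ->
  forall w, itint j k (fun w => f w + g w) w = itint j k f w + itint j k g w.
Proof.
move=> mf mg; elim: k j => //= k IH j w.
rewrite /intcoord -ge0_integralD//; try by
  [move=> x _; apply (ge0mfun_itint _ _ mf).2
  |move=> x _; apply (ge0mfun_itint _ _ mg).2
  |apply/ge0mfun_upd/ge0mfun_itint].
by apply: eq_integral => x _; rewrite IH.
Qed.

Lemma intcoord_id i f : depends_below i f -> (forall w, f w \is a fin_num) ->
  intcoord i f = f.
Proof.
move=> fi ffin; apply/funext => w; rewrite /intcoord.
under eq_integral => x _.
  rewrite (fi _ w); last by move=> j ji; rewrite /upd lt_eqF.
  over.
by rewrite -(fineK (ffin w)) integral_cst// [X in _ * X]probability_setT mule1.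
Qed.

Lemma itint_id j k f : depends_below j f -> (forall w, f w \is a fin_num) ->
  itint j k f = f.
Proof.
move=> fj ffin; elim: k j fj => //= k IH j fj; rewrite IH ?intcoord_id//.
exact: depends_below_le fj.
Qed.

Lemma itint_cat j k l f : itint j (k + l) f = itint j k (itint (j + k) l f).
Proof.
elim: k j => [|k IH] j /=; first by rewrite addn0.
by rewrite IH addSnnS.
Qed.

(** Integrating a further coordinate, on which [f] does not depend, against a probability changes
    nothing. *)
Lemma itint_stable j k l f : depends_below (j + k) f ->
  (forall w, f w \is a fin_num) -> (k <= l)%N -> itint j l f = itint j k f.
Proof. by move=> fd ff kl; rewrite -{1}(subnKC kl) itint_cat (itint_id _ fd). Qed.

Lemma depends_below_intcoord j f :
  depends_below j.+1 f -> depends_below j (intcoord j f).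
Proof.
move=> fj w w' ww'; apply: eq_integral => x _; apply: fj => i.
by rewrite /upd ltnS leq_eqVlt; case: eqP => //= _ /ww'.
Qed.

Lemma depends_below_itint j k f :
  depends_below (j + k) f -> depends_below j (itint j k f).
Proof.
elim: k j => [|k IH] j /=; first by rewrite addn0.
by rewrite -addSnnS => /IH; exact: depends_below_intcoord.
Qed.

Definition indE (A : set (seqspace T)) (w : seqspace T) : \bar R := (\1_A w)%:E.

Lemma ge0mfun_indE A : measurable A -> ge0mfun (indE A).
Proof.
move=> mA; split; last by move=> w; rewrite lee_fin.
exact/measurable_EFinP/measurable_indic.
Qed.

Lemma depends_below_indE n A : depends_below n A -> depends_below n (indE A).
Proof.
move=> An w w' ww'; rewrite /indE !indicE; congr ((nat_of_bool _)%:R%:E).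
by apply/idP/idP; rewrite !inE (An _ _ ww').
Qed.

Lemma itint_le1 j k f : ge0mfun f -> (forall w, f w <= 1) ->
  forall w, itint j k f w <= 1.
Proof.
move=> mf f1 w.
have := @le_itint j k f (cst 1) mf _ f1 w.
rewrite (@itint_id j k (cst 1)) //; apply.
by split=> //; exact: measurable_cst.
Qed.

End iterated_integral.

(** * The content on cylinders and its continuity at the empty set *)

Section product_content.
Context {d} {T : measurableType d} {R : realType}.
Variable P : nat -> probability T R.
Local Open Scope ereal_scope.

(** Let [B k] be the set of the [x] at which [f k] is at least [e / 2]. As
    [f k <= \1_(B k) + e / 2], it has probability at least [e / 2]. The [B k] decrease, so their
    intersection has this probability too and cannot be empty. *)
Lemma intcoord_half j (f : (seqspace T -> \bar R)^nat) w (e : R) :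
  (0 < e)%R -> (forall k, ge0mfun (f k)) -> (forall k v, f k v <= 1) ->
  (forall k v, f k.+1 v <= f k v) ->
  (forall k, e%:E <= intcoord P j (f k) w) ->
  exists x, forall k, (e / 2)%:E <= f k (upd w j x).
Proof.
move=> e0 mf f1 fS fe.
have e20 : (0 < e / 2)%R by rewrite divr_gt0.
pose B k := [set x | (e / 2)%:E <= f k (upd w j x)].
have mB k : measurable (B k).
  rewrite -[B k]setTI.
  by apply: emeasurable_fun_c_infty => //; exact: (ge0mfun_upd j w (mf k)).
have PB k : (e / 2)%:E <= P j (B k).
  have : e%:E <= \int[P j]_x ((\1_(B k) x)%:E + (e / 2)%:E).
    apply: (le_trans (fe k)); apply: ge0_le_integral => //.
    - by move=> x _; apply (mf k).2.
    - exact: (ge0mfun_upd j w (mf k)).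
    - apply: emeasurable_funD => //.
      exact/measurable_EFinP/measurable_indic.
    move=> x _; rewrite indicE; case: (boolP (x \in B k)) => [_|].
      by rewrite (le_trans (f1 k _))// leeDl// lee_fin ltW.
    by rewrite notin_setE/= => /negP; rewrite -ltNge add0e => /ltW.
  rewrite ge0_integralD//; last 2 first.
  - exact/measurable_EFinP/measurable_indic.
  - by move=> x _; rewrite lee_fin ltW.
  rewrite integral_indic// setIT integral_cst// [X in _ * X]probability_setT.
  rewrite mule1 -leeBlDr// -EFinB.
  by congr (_%:E <= _); rewrite {1}(splitr e) addrK.
have niB : nonincreasing_seq B.
  apply/nonincreasing_seqP => n; apply/subsetPset => x /= Bx.
  exact: le_trans Bx (fS n _).
have PBI : (e / 2)%:E <= P j (\bigcap_k B k).
  have cB : P j \o B @ \oo --> P j (\bigcap_k B k).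
    apply: nonincreasing_cvg_mu => //; last exact: bigcapT_measurable.
    by rewrite ltey_eq fin_num_measure.
  rewrite -(cvg_lim _ cB)//; apply: lime_ge; first by apply/cvg_ex; eexists; exact: cB.
  exact: nearW.
have [BI0|/set0P[x Bx]] := eqVneq (\bigcap_k B k) set0.
  by move: PBI; rewrite BI0 measure0 lee_fin leNgt e20.
by exists x => k; exact: Bx.
Qed.

Lemma itint_ge0 j k f : (forall w, 0 <= f w) ->
  forall w, 0 <= itint P j k f w.
Proof.
by move=> f0; elim: k j => //= k IH j w; apply: integral_ge0 => x _; exact: IH.
Qed.

(* The sequence is eventually constant when [A] is a cylinder; [maxe 0] only
   serves to make the content nonnegative on arbitrary sets. *)
Definition prodcontent (A : set (cylspace T)) : \bar R :=
  maxe 0 (limn (fun n => itint P 0 n (indE A) point)).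

Lemma indE_fin (A : set (seqspace T)) w : indE A w \is a @fin_num R.
Proof. by []. Qed.

(** The base point is arbitrary because every coordinate on which [A] depends has been integrated
    out. *)
Lemma prodcontentE n (A : set (cylspace T)) w : depends_below n A ->
  prodcontent A = itint P 0 n (indE A) w.
Proof.
move=> An; rewrite (_ : itint _ _ _ _ w = itint P 0 n (indE A) point); last first.
  exact: (@depends_below_itint _ _ _ P 0 n _ (depends_below_indE An)).
rewrite /prodcontent (_ : limn _ = itint P 0 n (indE A) point).
  by apply: max_r; apply: itint_ge0 => v; rewrite lee_fin.
apply: cvg_lim => //; apply: cvg_near_cst; exists n => // m /= nm.
by rewrite (itint_stable (j := 0) P (depends_below_indE An) (indE_fin _) nm).
Qed.

Lemma prodcontent_ge0 A : 0 <= prodcontent A.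
Proof. by rewrite le_max lexx. Qed.

Lemma prodcontentU (A B : set (cylspace T)) : measurable A -> measurable B ->
  A `&` B = set0 -> prodcontent (A `|` B) = prodcontent A + prodcontent B.
Proof.
move=> [mA [n An]] [mB [m Bm]] AB0.
have AN := depends_below_le (leq_maxl n m) An.
have BN := depends_below_le (leq_maxr n m) Bm.
have ABN : depends_below (maxn n m) (A `|` B).
  by move=> w w' ww'; rewrite /setU /= (AN _ _ ww') (BN _ _ ww').
rewrite (prodcontentE point ABN) (prodcontentE point AN) (prodcontentE point BN).
rewrite -itintD; try exact: ge0mfun_indE.
congr (itint _ _ _ _ _); apply/funext => w.
rewrite /indE -EFinD !indicE in_setU; case: (boolP (w \in A)) => [|_].
  rewrite inE => Aw; case: (boolP (w \in B)) => /=; last by rewrite addr0.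
  by rewrite inE => Bw; have : (A `&` B) w by []; rewrite AB0.
by rewrite add0r.
Qed.

(* If the contents stayed above [e], fixing the coordinates one after the other
   while keeping the integral over the remaining ones above [e / 2 ^+ j] for all
   the sets at once would produce a point of the intersection. *)
Lemma prodcontent_cvg0 (A : (set (cylspace T))^nat) :
  (forall k, measurable (A k)) -> (forall k, A k.+1 `<=` A k) ->
  \bigcap_k A k = set0 ->
  forall e : R, (0 < e)%R -> exists k, prodcontent (A k) < e%:E.
Proof.
move=> mA niA A0 e e0; apply: contrapT => /forallNP nA.
have {}nA k : e%:E <= prodcontent (A k) by rewrite leNgt; apply/negP/nA.
have mA' k : measurable (A k : set (seqspace T)) by have [] := mA k.
have /choice[N AN] : forall k, exists n, depends_below n (A k).
  by move=> k; have [] := mA k.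
pose g k j := itint P j (N k - j) (indE (A k)).
have indN j k : depends_below (j + (N k - j)) (@indE _ _ R (A k)).
  by apply: depends_below_le (depends_below_indE (AN k)); lia.
have gE k j M : (N k <= j + M)%N -> itint P j M (indE (A k)) = g k j.
  move=> NM; apply: itint_stable => //; lia.
have mg k j : ge0mfun (g k j) by exact/ge0mfun_itint/ge0mfun_indE.
have g1 k j w : g k j w <= 1.
  by apply: itint_le1 (ge0mfun_indE (mA' k)) _ _ => v;
    rewrite lee_fin indicE lern1 leq_b1.
have gS k j w : g k.+1 j w <= g k j w.
  rewrite -(gE k j (maxn (N k) (N k.+1))); last by lia.
  rewrite -(gE k.+1 j (maxn (N k) (N k.+1))); last by lia.
  apply: le_itint; [exact: ge0mfun_indE..|move=> v].
  rewrite lee_fin !indicE ler_nat; case: (boolP (v \in A k.+1)) => //.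
  by rewrite inE => /niA; rewrite -in_setE => ->.
have gI k j : intcoord P j (g k j.+1) = g k j.
  by rewrite -(gE k j (N k - j.+1).+1)//; lia.
pose Q j w := forall k, (e / 2 ^+ j)%:E <= g k j w.
(* The implication stands under the existential so that the axiom of choice yields a total function,
   which drives the recursion [ws]. *)
have QS j w : exists x, Q j w -> Q j.+1 (upd w j x).
  have [Qw|nQ] := pselect (Q j w); last by exists point.
  have e2j : (0 < e / 2 ^+ j)%R by rewrite divr_gt0// exprn_gt0.
  have gw k : (e / 2 ^+ j)%:E <= intcoord P j (g k j.+1) w by rewrite gI.
  have [x xP] := intcoord_half e2j (mg ^~ j.+1) (g1 ^~ j.+1) (gS ^~ j.+1) gw.
  by exists x => _ k; rewrite exprSr invfM mulrA.
have /choice[c cP] : forall p : nat * (nat -> T), exists x,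
    Q p.1 p.2 -> Q p.1.+1 (upd p.2 p.1 x) by move=> p; exact: QS.
pose ws := fix ws n := if n is m.+1 then upd (ws m) m (c (m, ws m)) else point.
have Qws j : Q j (ws j).
  elim: j => [k|j IH]; last exact: (cP (j, ws j)).
  rewrite expr0 divr1 -(gE k 0%N (N k))// -prodcontentE//.
(* The coordinate [j] is set at stage [j.+1], and later stages leave it alone. *)
pose w : seqspace T := fun j => ws j.+1 j.
have wsE i j : (i < j)%N -> ws j i = w i.
  elim: j => // j IH; rewrite ltnS leq_eqVlt => /orP[/eqP->//|ij].
  by rewrite /= /upd ltn_eqF//; exact: IH.
suff : (\bigcap_k A k) w by rewrite A0.
move=> k _.
(* At stage [N k] no integral is left: the indicator of [A k] itself is bounded below by a positive
   number. *)
have := Qws (N k) k; rewrite /g subnn /=.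
rewrite (depends_below_indE (AN k) (w' := w)); last by move=> i; exact: wsE.
rewrite /indE lee_fin indicE; case: (boolP (w \in A k)); first by rewrite inE.
by rewrite leNgt divr_gt0// exprn_gt0.
Qed.

End product_content.

(** * Extension of the content to a probability measure *)

Section product_probability.
Context {d} {T : measurableType d} {R : realType}.
Variable P : nat -> probability T R.
Local Open Scope ereal_scope.

Let prodcontent0 : prodcontent P set0 = 0.
Proof.
rewrite (@prodcontentE _ _ _ P 0 set0 point)//.
by rewrite /= /indE indicE in_set0.
Qed.

(** Finite additivity splits [U] into the first [k] sets and the remainder [A k]. The remainders
    decrease to the empty set, so their contents become arbitrarily small. *)
Lemma prodcontent_semi_sigma_additive : semi_sigma_additive (prodcontent P).
Proof.
move=> F mF tF mU; set U := \bigcup_n F n in mU *.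
pose A := fix A n := if n is m.+1 then A m `\` F m else U.
have mA k : measurable (A k).
  by elim: k => //= k IH; apply: measurableD.
have AP k w : A k w <-> U w /\ forall i, (i < k)%N -> ~ F i w.
  elim: k => [|k IH] /=; first by split=> [|[]].
  split=> [[/IH[Uw Fw] Fkw]|[Uw Fw]].
    by split=> // i; rewrite ltnS leq_eqVlt => /orP[/eqP->|/Fw].
  split; last exact: Fw.
  by apply/IH; split => // i ik; apply: Fw; apply: ltnW.
have FA k : F k `<=` A k.
  move=> w Fkw; apply/AP; split; first by exists k.
  move=> i ik Fiw; have : (F i `&` F k) w by [].
  by rewrite (trivIsetP.1 tF)// ltn_eqF.
have SA k : prodcontent P U = \sum_(0 <= i < k) prodcontent P (F i)
                              + prodcontent P (A k).
  elim: k => [|k ->]; first by rewrite big_nil add0e.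
  rewrite big_nat_recr//= -addeA; congr +%E.
  rewrite -prodcontentU//; last first.
  - by apply/seteqP; split => // w [? []].
  - exact: (mA k.+1).
  by congr prodcontent; rewrite /= setDUK.
have F0 i : 0 <= prodcontent P (F i) by exact: prodcontent_ge0.
have A0 : \bigcap_k A k = set0.
  apply/seteqP; split => // w Aw.
  have /AP[[i _ Fiw] _] := Aw 0%N I.
  by have /AP[_ /(_ i (ltnSn i))] := Aw i.+1 I.
have ndS : nondecreasing_seq (fun n => \sum_(0 <= i < n) prodcontent P (F i)).
  by apply: ereal_nondecreasing_series => i _ _; exact: F0.
suff -> : prodcontent P U =
    ereal_sup (range (fun n => \sum_(0 <= i < n) prodcontent P (F i))).
  exact: ereal_nondecreasing_cvgn.
apply/eqP; rewrite eq_le; apply/andP; split; last first.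
  apply: ge_ereal_sup => _ [k _ <-].
  by rewrite (SA k) leeDl// prodcontent_ge0.
apply/lee_addgt0Pr => e e0.
have [k Ake] := prodcontent_cvg0 P mA (fun k => @subDsetl _ _ _) A0 e0.
rewrite (SA k) leeD//; last exact: ltW.
by apply: ereal_sup_ubound; exists k.
Qed.

HB.instance Definition _ := isMeasure.Build _ (cylspace T) R (prodcontent P)
  prodcontent0 (prodcontent_ge0 P) prodcontent_semi_sigma_additive.

Definition iprod : set (seqspace T) -> \bar R := measure_extension (prodcontent P).

Let iprod0 : iprod set0 = 0. Proof. exact: measure0. Qed.

Let iprod_ge0 A : 0 <= iprod A. Proof. exact: measure_ge0. Qed.

Let iprod_semi_sigma_additive : semi_sigma_additive iprod.
Proof.
move=> F mF tF mUF; rewrite /iprod.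
apply: (@measure_semi_sigma_additive _ _ _ (measure_extension (prodcontent P))).
- by move=> i; exact: seq_sigma_cylinder.
- by [].
- exact: seq_sigma_cylinder.
Qed.

HB.instance Definition _ := isMeasure.Build _ (seqspace T) R iprod
  iprod0 iprod_ge0 iprod_semi_sigma_additive.

Lemma iprodE A : cylinder A -> iprod A = prodcontent P A.
Proof. by move=> mA; rewrite /iprod /measure_extension measurable_mu_extE. Qed.

Let iprod_setT : iprod setT = 1.
Proof.
rewrite iprodE; last exact: (@measurableT _ (cylspace T)).
rewrite (@prodcontentE _ _ _ P 0 setT point)//.
by rewrite /= /indE indicT.
Qed.

HB.instance Definition _ := Measure_isProbability.Build _ (seqspace T) R iprod
  iprod_setT.

Section box.
Variable A : nat -> set T.
Hypothesis mA : forall i, measurable (A i).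

Let box n : set (seqspace T) := [set w | forall i, (i < n)%N -> A i (w i)].

Let boxE n : box n = \bigcap_(i < n) ((fun w => w i) @^-1` A i).
Proof. by apply/seteqP; split => w. Qed.

Let cylinder_box n : cylinder (box n).
Proof.
split.
  rewrite boxE; apply: bigcap_measurableType => // i _.
  by rewrite -[X in measurable X]setTI; exact: measurable_coord.
exists n => w w' ww'; apply/propext; split => Aw i ni.
  by rewrite -ww'//; exact: Aw.
by rewrite ww'//; exact: Aw.
Qed.

Let indE_box_upd j w x :
  @indE _ _ R (box j.+1) (upd w j x) = indE (box j) w * (\1_(A j) x)%:E.
Proof.
rewrite /indE -EFinM !indicE -natrM mulnb; congr (_%:R%:E).
suff -> : (upd w j x \in box j.+1) = (w \in box j) && (x \in A j) by [].
apply/idP/andP; rewrite !inE.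
  move=> Aw; split; last by have := Aw j (ltnSn j); rewrite /upd eqxx.
  by move=> i ij; have := Aw i (ltnW ij); rewrite /upd ltn_eqF.
move=> [Aw Ax] i; rewrite ltnS leq_eqVlt /upd; case: eqP => [->//|_ /= ij].
exact: Aw.
Qed.

(** Coordinates below [j] are still free, whence the factor [indE (box j) w]; integrating coordinate
    [j] turns its indicator into [P j (A j)]. *)
Let itint_box j k w : itint P j k (indE (box (j + k))) w =
  indE (box j) w * \prod_(i < k) P (j + i)%N (A (j + i)%N).
Proof.
elim: k j w => [|k IH] j w; first by rewrite /= addn0 big_ord0 mule1.
have prod_ge0 : 0 <= \prod_(i < k) P (j.+1 + i)%N (A (j.+1 + i)%N).
  exact: prode_ge0.
rewrite /= /intcoord -addSnnS; under eq_integral do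
  rewrite IH indE_box_upd muleAC.
rewrite ge0_integralZl//; last 2 first.
- exact/measurable_EFinP/measurable_indic.
- by rewrite mule_ge0// lee_fin.
rewrite integral_indic// setIT big_ord_recl addn0 -muleA; congr *%E.
rewrite muleC; congr *%E; apply: eq_bigr => i _.
by rewrite lift0 addSnnS.
Qed.

Lemma iprod_box n : iprod (box n) = \prod_(i < n) P i (A i).
Proof.
rewrite iprodE; last exact: cylinder_box.
have [_ _] := cylinder_box n.
rewrite (@prodcontentE _ _ _ P n _ point).
  rewrite (itint_box 0) /indE (_ : box 0 = setT); last first.
    by apply/seteqP; split.
  by rewrite indicT mul1e.
move=> w w' ww'; apply/propext; split => Aw i ni.
  by rewrite -ww'//; exact: Aw.
by rewrite ww'//; exact: Aw.
Qed.

(** The finite boxes decrease to the infinite one, and the measure is continuous from above. *)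
Lemma iprod_allbox :
  (fun n => \prod_(i < n) P i (A i)) @ \oo -->
  iprod [set w | forall i, A i (w i)].
Proof.
under eq_fun do rewrite -iprod_box.
rewrite (_ : [set _ | _] = \bigcap_n box n); last first.
  apply/seteqP; split => [w Aw n _ i _|w Aw i]; first exact: Aw.
  exact: (Aw i.+1).
have mbox n : measurable (box n) by have [] := cylinder_box n.
apply: nonincreasing_cvg_mu => //.
- by rewrite ltey_eq fin_num_measure.
- exact: bigcapT_measurable.
- by move=> m n mn; apply/subsetPset => w Aw i im; apply/Aw/(leq_trans im).
Qed.

End box.

End product_probability.

(** * Avoidance probabilities of Poisson processes *)

Section poisson_process.
Context {d} {E : measurableType d} {R : realType}.
Local Open Scope ereal_scope.

Lemma poisson_prob1 (r : R) n : (0 <= r)%R ->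
  poisson_prob r 0 [set n] = (r ^+ n / n`!%:R * expR (- r))%:E.
Proof.
(* At [r = 0] the law is the Dirac mass at 0, which agrees with the formula because [0 ^+ 0 = 1]. *)
rewrite le_eqVlt => /orP[/eqP<-|r0].
  rewrite /poisson_prob ltxx diracE oppr0 expR0 mulr1; case: n => [|n].
    by rewrite expr0 divr1 mem_set.
  by rewrite expr0n mul0r memNset.
by rewrite /poisson_prob r0 esum_set1 /poisson_pmf r0// lee_fin
  mulr_ge0 ?expR_ge0// divr_ge0// exprn_ge0// ltW.
Qed.

Definition avoid (B : set E) : set (nat * seqspace E) :=
  [set p | forall i, (i < p.1)%N -> ~ B (p.2 i)].

Lemma avoidE B : avoid B =
  \bigcup_n ([set n] `*` [set xi : seqspace E | forall i, (i < n)%N -> (~` B) (xi i)]).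
Proof.
apply/seteqP; split => [[n xi] H|[n xi] [m _ [/= ->]]]; last exact.
by exists n.
Qed.

Lemma measurable_avoid_slice B n : measurable B ->
  measurable [set xi : seqspace E | forall i, (i < n)%N -> (~` B) (xi i)].
Proof.
move=> mB; rewrite (_ : [set _ | _] = \bigcap_(i < n) ((fun w => w i) @^-1` (~` B))).
  apply: bigcap_measurableType => // i _.
  by rewrite -[X in measurable X]setTI; apply: measurable_coord => //; exact: measurableC.
by apply/seteqP; split => w.
Qed.

Lemma measurable_avoid B : measurable B -> measurable (avoid B).
Proof.
move=> mB; rewrite avoidE; apply: bigcupT_measurable => n.
by apply: measurableX => //; exact: measurable_avoid_slice.
Qed.

Section finite.
Variable m : {finite_measure set E -> \bar R}.

(* A Poisson process with finite intensity [m] has a Poisson number [n] of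
   points, which are the first [n] terms of an independent sequence with law
   [m] normalized ([point] is the junk value of the law when [m] is zero). *)
Definition config : probability (nat * seqspace E)%type R :=
  poisson_prob (fine (m setT)) 0 \x iprod (fun=> mnormalize m point).

(** Given their number, the points miss [B] independently with probability [q]. Summing over the
    number of points gives [exp (- r) * \sum_n (r q)^n / n! = exp (- r (1 - q))], and
    [r (1 - q) = m B]. *)
Lemma config_avoid B : measurable B ->
  config (avoid B) = (expR (- fine (m B)))%:E.
Proof.
move=> mB; pose r := fine (m setT); pose Q : probability E R := mnormalize m point.
have r0 : (0 <= r)%R by rewrite fine_ge0.
have mBfin : m B \is a fin_num by exact: fin_num_measure.
have mTfin : m setT \is a fin_num by exact: fin_num_measure.
(* When [m] is zero, [Q] is the junk law, but both sides vanish. *)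
have rQ : (r * fine (Q B) = fine (m B))%R.
  rewrite /Q /= /mnormalize; case: ifPn => [/orP[|/eqP mT]|].
  - move=> /eqP mT; have : m B <= m setT by rewrite le_measure// inE.
    rewrite mT => mB0; have -> : m B = 0 by apply/eqP; rewrite eq_le mB0 measure_ge0.
    by rewrite /r mT mul0r.
  - by move: mTfin; rewrite mT.
  rewrite negb_or => /andP[mT0 _].
  rewrite fineM//= mulrCA mulfV ?mulr1// fine_eq0//.
have QBfin : Q B \is a fin_num by exact: fin_num_measure.
pose q := (1 - fine (Q B))%R.
have QC : Q (~` B) = q%:E by rewrite probability_setC// EFinB fineK.
have q0 : (0 <= q)%R by rewrite -lee_fin -QC measure_ge0.
rewrite avoidE measure_bigcup//; last 2 first.
  - move=> n _; apply: measurableX => //; exact: measurable_avoid_slice.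
  - by move=> i j _ _ [[n xi] [[/= -> _] [/= -> _]]].
transitivity (\sum_(n <oo) ((expR (- r))%:E * (exp_coeff (r * q) n)%:E)).
  rewrite [LHS](_ : _ =
      \sum_(n <oo | n \in setT) ((expR (- r))%:E * (exp_coeff (r * q) n)%:E)).
    by apply: eq_eseriesl => n; rewrite in_setT.
  apply: eq_eseriesr => n _.
  rewrite /config/= product_measure1E//; last exact: measurable_avoid_slice.
  have P2 : iprod (fun=> Q)
      [set xi : seqspace E | forall i, (i < n)%N -> (~` B) (xi i)] = (q ^+ n)%:E.
    rewrite (@iprod_box _ _ _ _ (fun=> ~` B)); last by move=> _; exact: measurableC.
    by under eq_bigr do rewrite QC; rewrite prodEFin prodr_const card_ord.
  transitivity (poisson_prob r 0 [set n] * iprod (fun=> Q)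
      [set xi : seqspace E | forall i, (i < n)%N -> (~` B) (xi i)]); first by [].
  rewrite P2 poisson_prob1//.
  by rewrite -!EFinM /exp_coeff /= exprMn; congr EFin; ring.
rewrite nneseriesZl; last by move=> n _; rewrite lee_fin exp_coeff_ge0// mulr_ge0.
rewrite (_ : \sum_(n <oo) _ = (expR (r * q))%:E).
  by rewrite -EFinM -expRD /q mulrBr mulr1 rQ addKr.
rewrite /expR -EFin_lim; last exact: is_cvg_series_exp_coeff.
apply/congr_lim/funext => n /=; rewrite /series/= -sumEFin.
by [].
Qed.

End finite.

(* The points of the process are the [pt m i w] for which [on m i w] holds. *)
Lemma poisson_void (L : {sfinite_measure set E -> \bar R}) :
  exists (d' : measure_display) (W : measurableType d') (Pi : probability W R)
    (on : nat -> nat -> set W) (pt : nat -> nat -> W -> E),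
  [/\ forall m i, measurable (on m i),
      forall m i, measurable_fun setT (pt m i) &
      forall B, measurable B -> L B < +oo ->
        Pi [set w | forall m i, on m i w -> ~ B (pt m i w)] =
        (expR (- fine (L B)))%:E].
Proof.
(* The intensity [L] is a countable sum of finite measures [s m]. Independent Poisson processes with
   these intensities jointly avoid [B] with probability [\prod_m exp (- s m B) = exp (- L B)]. *)
pose s := sfinite_measure_seq L.
pose W : measurableType _ := seqspace (nat * seqspace E)%type.
exists _, W, (iprod (fun m => config (s m))).
exists (fun m i => [set w | (i < (w m).1)%N]), (fun m i w => (w m).2 i); split.
- move=> m i; rewrite -[X in measurable X]setTI.
  apply: (measurableT_comp (measurable_fst) (measurable_coord m) measurableT
    (Y := [set n | (i < n)%N])).
  by [].
- move=> m i.
  exact: (measurableT_comp (measurable_coord i)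
    (measurableT_comp measurable_snd (measurable_coord m))).
move=> B mB LB.
have := @iprod_allbox _ _ _ (fun m => config (s m)) (fun=> avoid B)
  (fun=> measurable_avoid mB).
move=> cA; apply: (cvg_unique _ cA) => //.
rewrite (_ : (fun _ => _) = fun n =>
    (expR (- (\sum_(0 <= m < n) fine (s m B))))%:E); last first.
  apply/funext => n; rewrite big_mkord -sumrN expR_sum -prodEFin.
  by apply: eq_bigr => i _; exact: config_avoid.
apply: cvg_EFin; first exact: nearW.
apply: (@cvg_comp _ _ _ _ (fun x => expR (- x)) _ (nbhs (fine (L B)))).
  have sfin i : s i B \is a fin_num by exact: fin_num_measure.
  have LBfin : L B \is a fin_num by rewrite ge0_fin_numE.
  have : (fun n => \sum_(0 <= m < n) s m B) @ \oo --> (fine (L B))%:E.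
    rewrite fineK// sfinite_measure_seqP//.
    by apply: is_cvg_nneseries => n _ _.
  move=> /fine_cvg; apply: cvg_trans; apply: near_eq_cvg; apply: nearW => n /=.
  by rewrite sum_fine// => i _; exact: sfin.
by apply: (cvg_comp _ _ (cvgN cvg_id)); exact: continuous_expR.
Qed.

End poisson_process.

(** * Max-stability in terms of distribution functions *)

Section tuple_boxes.
Context {R : realType} (n : nat).

Definition lower_box (x : 'I_n -> R) : set (n.-tuple R) :=
  [set v | forall i, tnth v i <= x i].

Definition lower_boxes : set (set (n.-tuple R)) := range lower_box.

Lemma measurable_lower_box x : measurable (lower_box x).
Proof.
rewrite (_ : lower_box x = \bigcap_(i in [set: 'I_n])
    ((fun v => tnth v i) @^-1` `]-oo, x i])); last first.
  apply/seteqP; split => v vx i; last by have := vx i I; rewrite /= in_itv.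
  by rewrite /= in_itv/= vx.
apply: fin_bigcap_measurable; first exact: finite_finset.
by move=> i _; rewrite -[X in measurable X]setTI; exact: measurable_tnth.
Qed.

Lemma lower_boxes_setI : setI_closed lower_boxes.
Proof.
move=> _ _ [x _ <-] [y _ <-]; exists (fun i => Num.min (x i) (y i)) => //.
apply/seteqP; split => v /=.
  by move=> vxy; split => i; have := vxy i; rewrite le_min => /andP[].
by move=> [vx vy] i; rewrite le_min vx vy.
Qed.

(** Two uses in one: [None] covers the space by countably many boxes, and [Some i] writes a
    half-space as a countable union of boxes. *)
Lemma lower_box_cover (i : option 'I_n) (a : R) :
  \bigcup_k lower_box (fun j => if Some j == i then a else k%:R) =
  [set v | if i is Some i then tnth v i <= a else True].
Proof.
apply/seteqP; split => v.
  by case: i => // i [k _ /(_ i)]; rewrite eqxx.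
move=> vi; pose k := \max_(j < n) Num.bound `|tnth v j|.
exists k => // j; case: eqP => [ji|_]; first by move: vi; rewrite -ji.
apply: (le_trans (ler_norm _)).
apply: (le_trans (ltW (archi_boundP (normr_ge0 _)))).
by rewrite ler_nat (leq_bigmax j).
Qed.

Lemma tuple_sigma_lower_boxes (A : set (n.-tuple R)) : measurable A ->
  <<s lower_boxes >> A.
Proof.
apply: smallest_sub; first exact: smallest_sigma_algebra.
move=> B; rewrite -bigcup_seq => -[i _ [C mC <-]].
pose U : measurableType _ := g_sigma_algebraType lower_boxes.
suff mi : measurable_fun [set: U] (fun v : U => tnth v i).
  exact: mi.
apply: (measurability _ (RGenOInfty.measurableE R)) => // _ [_ [x ->] <-].
rewrite setTI (_ : _ @^-1` _ =
    ~` \bigcup_k lower_box (fun j => if Some j == Some i then x else k%:R)).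
  apply: measurableC; apply: bigcupT_measurable => k.
  by apply: sub_sigma_algebra; exact: imageT.
rewrite lower_box_cover; apply/seteqP; split => v /=; rewrite in_itv/= andbT.
  by rewrite ltNge => /negP.
by move=> /negP; rewrite -ltNge.
Qed.

(** Uniqueness of measures on a generating pi-system, here that of the lower boxes. *)
Lemma tuple_measure_unique (m1 m2 : {measure set (n.-tuple R) -> \bar R}) :
  (m1 setT < +oo)%E -> (forall x, m1 (lower_box x) = m2 (lower_box x)) ->
  forall A, measurable A -> m1 A = m2 A.
Proof.
move=> m1T m12 A mA.
apply: (g_sigma_algebra_measure_unique lower_boxes
  _ (fun k => lower_box (fun j => if Some j == None then 0 else k%:R))).
- by move=> _ [x _ <-]; exact: measurable_lower_box.
- by move=> k; exact: imageT.
- by rewrite [LHS](lower_box_cover None 0); apply/seteqP; split.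
- exact: lower_boxes_setI.
- by move=> _ [x _ <-].
- move=> k; apply: le_lt_trans m1T; apply: le_measure; rewrite ?inE//.
  exact: measurable_lower_box.
- exact: tuple_sigma_lower_boxes.
Qed.

End tuple_boxes.

Section same_fdd.
Context (R : realType) (T : choiceType).
Context d1 (Omega1 : measurableType d1) (P1 : probability Omega1 R).
Context d2 (Omega2 : measurableType d2) (P2 : probability Omega2 R).
Variables (X : T -> Omega1 -> R) (Y : T -> Omega2 -> R).
Hypothesis mX : forall t, measurable_fun setT (X t).
Hypothesis mY : forall t, measurable_fun setT (Y t).

Lemma same_fdd_cdf : (forall n (t : 'I_n -> T) (x : 'I_n -> R),
    P1 [set w | forall i, X (t i) w <= x i] =
    P2 [set w | forall i, Y (t i) w <= x i]) ->
  same_fdd P1 X P2 Y.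
Proof.
move=> XY n t B mB.
have mX' : measurable_fun setT (fun w => [tuple X (tnth t i) w | i < n]).
  apply/measurable_fun_tnthP => i; rewrite (_ : _ \o _ = X (tnth t i))//.
  by apply/funext => w /=; rewrite tnth_mktuple.
have mY' : measurable_fun setT (fun w => [tuple Y (tnth t i) w | i < n]).
  apply/measurable_fun_tnthP => i; rewrite (_ : _ \o _ = Y (tnth t i))//.
  by apply/funext => w /=; rewrite tnth_mktuple.
pose X' : {mfun Omega1 >-> n.-tuple R} :=
  HB.pack (fun w => [tuple X (tnth t i) w | i < n]) (isMeasurableFun.Build _ _ _ _ _ mX').
pose Y' : {mfun Omega2 >-> n.-tuple R} :=
  HB.pack (fun w => [tuple Y (tnth t i) w | i < n]) (isMeasurableFun.Build _ _ _ _ _ mY').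
apply: (tuple_measure_unique (m1 := distribution P1 X') (m2 := distribution P2 Y')) => //=.
  by rewrite probability_setT ltry.
move=> x; rewrite /distribution /pushforward.
transitivity (P1 [set w | forall i, X (tnth t i) w <= x i]).
  by congr (P1 _); apply/seteqP; split => w /= H i; have := H i; rewrite tnth_mktuple.
rewrite XY.
by congr (P2 _); apply/seteqP; split => w /= H i; have := H i; rewrite tnth_mktuple.
Qed.

End same_fdd.

(** * Independence of the coordinates under the product measure *)

Section iprod_independence.
Context {d} {T : measurableType d} {R : realType}.
Variable P : nat -> probability T R.
Local Open Scope ereal_scope.

Lemma iprod_coord i (A : set T) : measurable A ->
  iprod P [set w | A (w i)] = P i A.
Proof.
move=> mA; pose B j := if j == i then A else setT.
rewrite (_ : [set _ | _] = [set w | forall j, (j < i.+1)%N -> B j (w j)]); last first.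
  apply/seteqP; split => w /= Aw; last by have := Aw i (ltnSn i); rewrite /B eqxx.
  by move=> j _; rewrite /B; case: eqP => // ->.
rewrite iprod_box; last by move=> j; rewrite /B; case: ifP.
rewrite big_ord_recr/= /B eqxx big1 ?mul1e// => j _.
by rewrite ltn_eqF// probability_setT.
Qed.

Lemma iprod_independent n (A : 'I_n -> set T) : (forall i, measurable (A i)) ->
  iprod P (\bigcap_(i in [set: 'I_n]) [set w | A i (w i)]) =
  \prod_(i < n) P i (A i).
Proof.
(* [iprod_box] takes sets indexed by all of [nat], so [A] is continued by [setT]. *)
move=> mA; pose B (j : nat) := if insub j is Some i then A i else setT.
have BE (i : 'I_n) : B i = A i by rewrite /B valK.
under eq_bigr do rewrite -BE.
rewrite -iprod_box; last by move=> j; rewrite /B; case: insubP.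
congr (iprod P _); apply/seteqP; split => w /= Aw.
  by move=> i ni; have := Aw (Ordinal ni) I; rewrite /= -BE.
by move=> i _ /=; rewrite -BE; exact: Aw.
Qed.

End iprod_independence.

Lemma measurable_box {R : realType} {d} {U : measurableType d} k
    (f : 'I_k -> U -> R) (x : 'I_k -> R) :
  (forall i, measurable_fun setT (f i)) ->
  measurable [set w | forall i, f i w <= x i].
Proof.
move=> mf.
rewrite (_ : [set _ | _] = \bigcap_(i in [set: 'I_k]) (f i @^-1` `]-oo, x i])).
  apply: fin_bigcap_measurable; first exact: finite_finset.
  by move=> i _; rewrite -[Y in measurable Y]setTI; exact: mf.
apply/seteqP; split => w /= H i; last by have := H i I; rewrite /= in_itv.
by move=> _; rewrite /= in_itv/=; exact: H.
Qed.

Section max_stability.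
Context {R : realType} {T : choiceType} {d} {Omega : measurableType d}.
Variables (P : probability Omega R) (X : T -> {RV P >-> R}).

(** The left side is the joint distribution function of the maximum of [n.+1] independent copies, in
    the form in which independence delivers it. *)
Definition max_stable_cdf := forall n k (t : 'I_k -> T) (x : 'I_k -> R),
  (\prod_(j < n.+1) P [set w | forall i, (X (t i) w <= x i)%R])%E =
  P [set w | forall i, n.+1%:R * X (t i) w <= x i].

Lemma measurable_bigmax I (s : seq I) d' (U : measurableType d')
    (f0 : U -> R) (f : I -> U -> R) : measurable_fun setT f0 ->
  (forall i, measurable_fun setT (f i)) ->
  measurable_fun setT (fun w => \big[Num.max/f0 w]_(i <- s) f i w).
Proof.
move=> mf0 mf; elim: s => [|i s IH].
  by under eq_fun do rewrite big_nil.
by under eq_fun do rewrite big_cons; exact: measurable_maxr.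
Qed.

Lemma process_sigma_box d' (U : measurableType d') (Y : T -> U -> R)
    k (t : 'I_k -> T) (x : 'I_k -> R) :
  process_sigma Y [set w | forall i, Y (t i) w <= x i].
Proof.
pose V : measurableType _ := g_sigma_algebraType
  (\bigcup_t preimage_set_system [set: U] (Y t) measurable).
apply: (@measurable_box _ _ V _ (fun i => Y (t i))) => i _ B mB.
by apply: sub_sigma_algebra; exists (t i) => //; exists B.
Qed.

Lemma simple_max_stableI :
  (forall (t : T) (x : R), 0 < x -> P [set w | X t w <= x] = (expR (- (1 / x)))%:E) ->
  max_stable_cdf -> simple_max_stable X.
Proof.
move=> marg ms; split=> // n d' Omega' P' X' indX' fddX'.
apply: same_fdd_cdf.
- by move=> t; exact: measurable_bigmax.
- by move=> t; exact: measurable_funM.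
move=> k t x; rewrite -ms.
rewrite (_ : [set _ | _] = \bigcap_(j in [set: 'I_n.+1])
    [set w | forall i, X' j (t i) w <= x i]); last first.
  apply/seteqP; split => w /= H.
    by move=> j _ i /=; have /bigmax_leP[_ /(_ j isT)] := H i.
  by move=> i; apply/bigmax_leP; split=> [|j _]; exact: H.
rewrite indX'; last by move=> j; exact: process_sigma_box.
apply: eq_bigr => j _.
have := fddX' j k [tuple t i | i < k] (lower_box x) (measurable_lower_box x).
set A := [set w | _]; set B := [set w | _] => AB.
transitivity (P' A); [congr (P' _)|rewrite AB; congr (P _)];
  apply/seteqP; split => w /= H i; have := H i; rewrite !tnth_mktuple//.
Qed.

(** Max-stability is a statement about given independent copies, so some must be exhibited: the
    coordinates of the infinite power of [P] serve. *)
Lemma simple_max_stable_cdf : simple_max_stable X -> max_stable_cdf.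
Proof.
move=> [_ ms] n k t x.
have mX' (i : 'I_n.+1) (s : T) : measurable_fun [set: seqspace Omega] (fun w => X s (w i)).
  exact: measurableT_comp (measurable_coord i).
pose X' (i : 'I_n.+1) s : {RV iprod (fun=> P) >-> R} :=
  HB.pack (fun w : seqspace Omega => X s (w i))
    (isMeasurableFun.Build _ _ _ _ _ (mX' i s)).
(* Preimages under the [i]-th coordinate form a sigma-algebra, so every event of the [i]-th copy is
   one; independence then reduces to the product formula. *)
have sX' i E : process_sigma (fun s => X' i s : seqspace Omega -> R) E ->
    exists2 A, measurable A & E = [set w | A (w i)].
  suff : process_sigma (fun s => X' i s : seqspace Omega -> R) `<=`
      preimage_set_system setT (fun w : seqspace Omega => w i) measurable.
    by move=> H /H[A mA <-]; exists A => //; rewrite setTI.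
  apply: smallest_sub.
    exact/sigma_algebra_preimage/sigma_algebra_measurable.
  move=> _ [s _ [B mB <-]]; exists (X s @^-1` B).
    by rewrite -[X in measurable X]setTI; exact: measurable_funP.
  by rewrite !setTI.
have indX' : independent_processes (iprod (fun=> P))
    (fun i t => X' i t : seqspace Omega -> R).
  move=> E sE.
  have /choice[B BP] : forall i, exists A, measurable A /\ E i = [set w | A (w i)].
    by move=> i; have [A mA EiA] := sX' _ _ (sE i); exists A.
  transitivity (iprod (fun=> P) (\bigcap_(i in [set: 'I_n.+1]) [set w | B i (w i)])).
    by congr (iprod _ _); apply: eq_bigcapr => i _; exact: (BP i).2.
  rewrite (@iprod_independent _ _ _ (fun=> P) _ B); last by move=> i; exact: (BP i).1.
  apply: eq_bigr => i _; rewrite (BP i).2.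
  by rewrite -(iprod_coord (fun=> P) i (BP i).1).
have fddX' i : same_fdd (iprod (fun=> P)) (fun t => X' i t : seqspace Omega -> R)
    P (fun t => X t : Omega -> R).
  apply: same_fdd_cdf => // m s y.
  rewrite -(iprod_coord (fun=> P) i)//.
  exact: measurable_box.
have := ms n _ _ (iprod (fun=> P)) X' indX' fddX' k [tuple t i | i < k]
  (lower_box x) (measurable_lower_box x).
set A := [set w | _]; set B := [set w | _] => AB.
transitivity (P B); last first.
  congr (P _); apply/seteqP; split => w /= H i; have := H i; rewrite !tnth_mktuple//.
rewrite -AB.
pose C := [set w | forall i, X (t i) w <= x i].
rewrite -(@iprod_independent _ _ _ (fun=> P) _ (fun=> C)); last first.
  by move=> _; exact: (measurable_box x (fun i => measurable_funP (X (t i)))).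
congr (iprod _ _); apply/seteqP; split => w /= H.
  move=> i; rewrite !tnth_mktuple; apply/bigmax_leP.
  by split=> [|j _]; exact: H.
move=> j _ i /=; have := H i; rewrite !tnth_mktuple => /bigmax_leP[_].
exact.
Qed.

End max_stability.

(** * Extremal coefficients read off from distribution functions *)

Section ecf.
Context {R : realType} {T : choiceType} {d} {Omega : measurableType d}.
Variables (P : probability Omega R) (X : T -> {RV P >-> R}).

Definition cdf_fset (A : {fset T}) (x : R) : set Omega :=
  [set w | forall t, t \in A -> X t w <= x].

Lemma measurable_cdf_fset A x : measurable (cdf_fset A x).
Proof.
rewrite (_ : cdf_fset A x = \bigcap_(t in [set` A]) (X t @^-1` `]-oo, x])).
  apply: fin_bigcap_measurable; first exact: finite_fset.
  by move=> t _; rewrite -[Y in measurable Y]setTI; exact: measurable_funP.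
apply/seteqP; split => w /= H t tA; last by have := H t tA; rewrite /= in_itv.
by rewrite /= in_itv/=; exact: H.
Qed.

Lemma bigmaxe_cdf_fset (A : {fset T}) (x : R) :
  [set w | (\big[maxe/-oo]_(t <- A) (X t w)%:E <= x%:E)%E] = cdf_fset A x.
Proof.
rewrite /cdf_fset; apply/seteqP; split => w /=.
  move=> H t tA; rewrite -lee_fin; apply: le_trans H.
  by rewrite (big_fsetD1 t)//= le_max lexx.
move=> H; rewrite big_seq; apply: bigmax_le; first exact: leNye.
by move=> t tA; rewrite lee_fin H.
Qed.

Lemma ecf_of_cdf theta (A : {fset T}) (x : R) : ecf_of X theta -> 0 < x ->
  P (cdf_fset A x) = (expR (- (theta A / x)))%:E.
Proof.
move=> [_ th0 thE] x0.
have [->|A0] := eqVneq A fset0.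
  rewrite th0 mul0r oppr0 expR0 (_ : cdf_fset _ _ = setT) ?probability_setT//.
  by apply/seteqP; split.
have := thE A (elimN eqP A0) x x0; rewrite bigmaxe_cdf_fset.
have Pfin : P (cdf_fset A x) \is a fin_num.
  by rewrite fin_num_measure//; exact: measurable_cdf_fset.
rewrite -(fineK Pfin); have : 0 <= fine (P (cdf_fset A x)) by rewrite fine_ge0.
(* Probability zero is impossible: its logarithm [-oo] would make the real number [theta A]
   infinite. *)
move: (fine _) => r; rewrite le_eqVlt => /orP[/eqP<-|r0].
  by rewrite le0_lneNy// mulrNy gtr0_sg// mul1e.
rewrite lne_EFin// => -[->].
by rewrite mulNr opprK mulrAC mulfV ?gt_eqF// mul1r lnK.
Qed.

Lemma cdf_ecf_of theta : (forall A, 0 <= theta A) -> theta fset0 = 0 ->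
  (forall A x, 0 < x -> P (cdf_fset A x) = (expR (- (theta A / x)))%:E) ->
  ecf_of X theta.
Proof.
move=> th0 thempty thE; split => // A _ x x0.
rewrite bigmaxe_cdf_fset thE// lne_EFin ?expR_gt0// expRK.
by rewrite -EFinM -EFinN mulrN opprK mulrCA mulfV ?gt_eqF// mulr1.
Qed.

End ecf.

(** * The spectral measure *)

Section sigma_product.
Local Open Scope ereal_scope.
Context d1 d2 (T1 : measurableType d1) (T2 : measurableType d2) (R : realType).
Variable m1 : {sigma_finite_measure set T1 -> \bar R}.
Variable m2 : {sigma_finite_measure set T2 -> \bar R}.

(* The library instance making [m1 \x m2] sigma-finite is shadowed by the one
   for products of subprobabilities. *)
Definition sigma_product : set (T1 * T2) -> \bar R := m1 \x m2.

HB.instance Definition _ := Measure.on sigma_product.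

Let sigma_product_sigma_finite : sigma_finite setT sigma_product.
Proof.
have /sigma_finiteP[F [TF ndF Foo]] := sigma_finiteT m1.
have /sigma_finiteP[G [TG ndG Goo]] := sigma_finiteT m2.
exists (fun n => F n `*` G n) => [|k].
  apply/seteqP; split => // -[x y] _.
  have [i _ Fx] : (\bigcup_i F i) x by rewrite -TF.
  have [j _ Gy] : (\bigcup_i G i) y by rewrite -TG.
  exists (maxn i j) => //; split => /=.
    exact: (subsetPset _ _ (ndF _ _ (leq_maxl i j))).
  exact: (subsetPset _ _ (ndG _ _ (leq_maxr i j))).
have [mF Fk] := Foo k; have [mG Gk] := Goo k; split; first exact: measurableX.
by rewrite /sigma_product product_measure1E// lte_mul_pinfty// ge0_fin_numE.
Qed.

HB.instance Definition _ := Measure_isSigmaFinite.Build _ _ _ sigma_product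
  sigma_product_sigma_finite.

End sigma_product.

Section spectral.
Context {R : realType} {T : choiceType} {d} {Omega : measurableType d}.
Variables (P : probability Omega R) (X : T -> {RV P >-> R}).
Variables (nu : {sigma_finite_measure set R -> \bar R}) (kappa : R).
Hypothesis kappa0 : 0 < kappa.

Local Notation E := ((R * Omega) * measurableTypeR R)%type.

(* A point of [E] is [((l, omega), s)]. *)
Definition spectral_measure : {sfinite_measure set E -> \bar R} :=
  sigma_product (sigma_product nu P) (@lebesgue_measure R).

(** The intensity has Lebesgue measure on the whole line as its last factor; the test [0 < p.2]
    keeps only the points with positive [s]. *)
Definition spectral (t : T) (p : E) : R :=
  if (0 < p.2) && (1 < p.1.1 * X t p.1.2) then (kappa * p.2)^-1 else 0.

(** Comparison of [spectral t p] with a level [y >= 0], cleared of the inverse so that measurability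
    is immediate. *)
Definition exceeds (t : T) (y : R) (p : E) : bool :=
  [&& 0 < p.2, 1 < p.1.1 * X t p.1.2 & kappa * p.2 * y < 1].

Lemma spectral_ge0 t p : 0 <= spectral t p.
Proof.
rewrite /spectral; case: ifP => // /andP[p0 _].
by rewrite invr_ge0 mulr_ge0// ltW.
Qed.

Lemma lt_spectral t p y : 0 <= y -> (y < spectral t p) = exceeds t y p.
Proof.
move=> y0; rewrite /spectral /exceeds andbA.
case: (boolP (_ && _)) => [/andP[p0 _]|_] /=; last by rewrite ltNge y0.
by rewrite -[LHS](ltr_pM2l (mulr_gt0 kappa0 p0)) mulfV// gt_eqF// mulr_gt0.
Qed.

Lemma measurable_exceeds t y : measurable_fun setT (exceeds t y).
Proof.
have mX : measurable_fun [set: E] (fun p => p.1.1 * X t p.1.2).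
  apply: measurable_funM.
    exact: measurableT_comp measurable_fst measurable_fst.
  apply: measurableT_comp; first exact: measurable_funP.
  exact: measurableT_comp measurable_snd measurable_fst.
apply: measurable_and; first exact: measurable_fun_ltr.
apply: measurable_and; first exact: measurable_fun_ltr.
apply: measurable_fun_ltr => //; apply: measurable_funM => //.
exact: measurable_funM.
Qed.

Lemma measurable_spectral t : measurable_fun setT (spectral t).
Proof.
apply: (measurability _ (RGenOInfty.measurableE R)) => // _ [_ [y ->] <-].
rewrite setTI; have [y0|y0] := leP 0 y.
  rewrite (_ : _ @^-1` _ = exceeds t y @^-1` [set true]).
    by rewrite -[X in measurable X]setTI; exact: measurable_exceeds.
  by apply/seteqP; split => p; rewrite /= in_itv/= andbT lt_spectral.
rewrite (_ : _ @^-1` _ = setT)//; apply/seteqP; split => // p _.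
by rewrite /= in_itv/= andbT (lt_le_trans y0)// spectral_ge0.
Qed.

Section hit.
Variables (k : nat) (t : 'I_k -> T).

Definition hit (x : 'I_k -> R) : set E :=
  [set p | exists i, x i < spectral (t i) p].

Lemma measurable_hit x : measurable (hit x).
Proof.
rewrite (_ : hit x =
    \bigcup_(i in [set: 'I_k]) (spectral (t i) @^-1` `]x i, +oo[)).
  apply: fin_bigcup_measurable; first exact: finite_finset.
  by move=> i _; rewrite -[Y in measurable Y]setTI; exact: measurable_spectral.
apply/seteqP; split => [p [i xi]|p [i _]]; rewrite /= ?in_itv/= ?andbT.
  by exists i => //; rewrite /= in_itv/= xi.
by exists i.
Qed.

(** The section of [hit x] at [q] is an open interval from 0 to this end point; the default 0 makes
    it empty when no [l X] exceeds 1. *)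
Let M (x : 'I_k -> R) (q : R * Omega) :=
  \big[Num.max/0]_(i | 1 < q.1 * X (t i) q.2) (kappa * x i)^-1.

Let lebesgue_hit x q : (forall i, 0 < x i) ->
  lebesgue_measure (xsection (hit x) q) = (M x q)%:E.
Proof.
move=> x0; have M0 : 0 <= M x q by exact: bigmax_ge_id.
rewrite (_ : xsection _ _ = `]0, M x q[%classic).
  rewrite lebesgue_measure_itv/= lte_fin; case: ltP => [_|M0'].
    by rewrite -EFinB subr0.
  by congr EFin; apply/eqP; rewrite eq_le M0.
apply/seteqP; split => s; rewrite /xsection /= inE /= in_itv/=.
  move=> [i]; rewrite lt_spectral ?ltW// => /and3P[/= s0 Xi si].
  rewrite s0/=; apply: lt_le_trans (le_bigmax_cond _ _ Xi).
  rewrite -(ltr_pM2r (mulr_gt0 kappa0 (x0 i))) mulVf ?gt_eqF ?mulr_gt0//.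
  by rewrite mulrA (mulrC s).
move=> /andP[s0 sM].
have [i Xi si] : exists2 i, 1 < q.1 * X (t i) q.2 & s < (kappa * x i)^-1.
  apply: contrapT => nex; move: sM; rewrite ltNge => /negP; apply.
  apply: bigmax_le => [|i Xi]; first exact: ltW.
  by rewrite leNgt; apply/negP => si; apply: nex; exists i.
exists i; rewrite lt_spectral ?ltW//; apply/and3P; split => //=.
rewrite (_ : kappa * s * x i = s * (kappa * x i)); last by ring.
by rewrite -ltr_pdivlMr ?mulr_gt0// div1r.
Qed.

(** The length [M] of the sections is homogeneous of degree -1 in the levels. This is what makes the
    Poisson part max-stable. *)
Lemma spectral_measure_hit_scale n x : (forall i, 0 < x i) ->
  (spectral_measure (hit (fun i => (x i / n.+1%:R)%R)) =
   n.+1%:R%:E * spectral_measure (hit x))%E.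
Proof.
move=> x0; rewrite /spectral_measure/= /sigma_product /product_measure1.
rewrite -ge0_integralZl//; last first.
  exact: (measurable_fun_xsection _ (measurable_hit x)).
apply: eq_integral => q _ /=; rewrite !lebesgue_hit//; last first.
  by move=> i; rewrite divr_gt0.
rewrite -EFinM; congr EFin; rewrite /M.
elim/big_ind2 : _ => [|a b c e -> ->|i _].
- by rewrite mulr0.
- by rewrite maxr_pMr.
- by rewrite mulrA invf_div.
Qed.

End hit.

End spectral.

Section spectral_ecf.
Context {R : realType} {T : choiceType} {d} {Omega : measurableType d}.
Variables (P : probability Omega R) (X : T -> {RV P >-> R}).
Variables (nu : {sigma_finite_measure set R -> \bar R}) (kappa : R).
Hypothesis kappa0 : 0 < kappa.
Hypothesis nu_pos : nu (~` `]0, +oo[) = 0%E.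
Variable theta : {fset T} -> R.
Hypothesis cdfX : forall A y, 0 < y ->
  P (cdf_fset X A y) = (expR (- (theta A / y)))%:E.
Variables (k : nat) (t : 'I_k -> T).

Local Notation A := [fset t i | i in 'I_k]%fset.

Lemma cdf_fsetE y : cdf_fset X A y = [set w | forall i, X (t i) w <= y].
Proof.
apply/seteqP; split => w /= H; first by move=> i; apply: H; exact: in_imfset.
by move=> _ /imfsetP[i _ ->]; exact: H.
Qed.

Let C : set (R * Omega) := [set q | exists i, 1 < q.1 * X (t i) q.2].

Let measurable_C : measurable C.
Proof.
rewrite (_ : C = \bigcup_(i in [set: 'I_k])
    ((fun q : R * Omega => q.1 * X (t i) q.2) @^-1` `]1, +oo[)).
  apply: fin_bigcup_measurable; first exact: finite_finset.
  move=> i _; rewrite -[Y in measurable Y]setTI.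
  have : measurable_fun setT (fun q : R * Omega => q.1 * X (t i) q.2).
    by apply: measurable_funM => //; exact: measurableT_comp.
  exact.
apply/seteqP; split => [q [i xi]|q [i _]]; rewrite /= ?in_itv/= ?andbT.
  by exists i => //; rewrite /= in_itv/= xi.
by exists i.
Qed.

(** For [l > 0], some [l X] exceeds 1 exactly when not all [X] on [A] are at most [1 / l]. *)
Let prob_C l : 0 < l -> P (xsection C l) = (1 - expR (- (l * theta A)))%:E.
Proof.
move=> l0; rewrite (_ : xsection C l = ~` cdf_fset X A l^-1).
  rewrite probability_setC; last exact: measurable_cdf_fset.
  by rewrite cdfX ?invr_gt0// invrK mulrC.
rewrite cdf_fsetE; apply/seteqP; split => w; rewrite /xsection /= inE /=.
  move=> [i Xi] /(_ i); apply/negP; rewrite -ltNge.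
  by rewrite -(ltr_pM2l l0) mulfV ?gt_eqF.
move=> /existsNP[i /negP]; rewrite -ltNge => Xi; exists i => /=.
by rewrite -(ltr_pM2l l0) mulfV ?gt_eqF in Xi.
Qed.

(** At a constant level the bound on [s] is the same for all indices, so the hit set is a product of
    [C] and an interval; Fubini and [prob_C] give the mass of [C]. *)
Lemma spectral_measure_hit_cst y : 0 < y ->
  spectral_measure P nu (hit X kappa t (fun=> y)) =
  (((kappa * y)^-1)%:E *
  \int[nu]_(l in `]0%R, +oo[) (1 - expR (- (l * theta A)))%:E)%E.
Proof.
move=> y0; have ky0 : 0 < (kappa * y)^-1 by rewrite invr_gt0 mulr_gt0.
rewrite (_ : hit _ _ _ _ = C `*` `]0, (kappa * y)^-1[%classic); last first.
  apply/seteqP; split => -[q s] /=.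
    move=> [i]; rewrite lt_spectral ?ltW// => /and3P[/= s0 Xi si].
    split; first by exists i.
    by rewrite in_itv/= s0 -[ltRHS]mul1r ltr_pdivlMr ?mulr_gt0// mulrCA mulrA.
  move=> [[i Xi]]; rewrite in_itv/= => /andP[s0 si].
  exists i; rewrite lt_spectral ?ltW//; apply/and3P; split => //=.
  rewrite (_ : kappa * s * y = s * (kappa * y)); last by ring.
  by rewrite -ltr_pdivlMr ?mulr_gt0// div1r.
rewrite /spectral_measure/= /sigma_product.
rewrite product_measure1E//=.
rewrite lebesgue_measure_itv/= lte_fin ky0 sube0 muleC; congr *%E.
rewrite /sigma_product /product_measure1.
(* Only [l > 0] may remain, since [prob_C] holds there; the rest is [nu]-null. *)
rewrite [LHS](ge0_negligible_integral _ _ _ _ nu_pos)//=; last 2 first.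
- by apply: measurableC; exact: measurable_itv.
- exact: (measurable_fun_xsection P measurable_C).
rewrite setTD setCK; apply: eq_integral => l; rewrite inE /= in_itv/= andbT.
exact: prob_C.
Qed.

End spectral_ecf.

(** * The superposition *)

Section positive_levels.
Context {R : realType} {T : choiceType} {d} {Omega : measurableType d}.
Variables (P : probability Omega R) (X : T -> {RV P >-> R}).
Hypothesis frechet : forall (t : T) (x : R), 0 < x ->
  P [set w | X t w <= x] = (expR (- (1 / x)))%:E.

Let measurable_le t (x : R) : measurable [set w | X t w <= x].
Proof.
rewrite (_ : [set _ | _] = X t @^-1` `]-oo, x]).
  by rewrite -[Y in measurable Y]setTI; exact: measurable_funP.
by apply/seteqP; split => w; rewrite /= in_itv.
Qed.

Lemma frechet_le0 t x : x <= 0 -> P [set w | X t w <= x] = 0%E.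
Proof.
move=> x0; apply/eqP; rewrite eq_le measure_ge0 andbT.
apply/lee_addgt0Pr => e e0; rewrite add0e.
apply: (@le_trans _ _ (P [set w | X t w <= e])).
  apply: le_measure; rewrite ?inE//= => w /= Xx.
  by rewrite (le_trans Xx)// (le_trans x0)// ltW.
(* [exp (- 1 / e) <= e] because [1 / e <= 1 + 1 / e <= exp (1 / e)]. *)
rewrite frechet// lee_fin expRN div1r -[leRHS]invrK lef_pV2 ?posrE ?expR_gt0//.
  by apply: le_trans (expR_ge1Dx _); rewrite lerDr.
by rewrite invr_gt0.
Qed.

(** If some level is not positive, both sides vanish: the margins have no mass there, and the
    product has at least one factor. *)
Lemma max_stable_cdf_pos :
  (forall n k (t : 'I_k -> T) (x : 'I_k -> R), (forall i, 0 < x i) ->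
    (\prod_(j < n.+1) P [set w | forall i, (X (t i) w <= x i)%R])%E =
    P [set w | forall i, X (t i) w <= x i / n.+1%:R]) ->
  max_stable_cdf X.
Proof.
move=> ms n k t x.
rewrite (_ : [set w | forall i, n.+1%:R * _ <= _] =
    [set w | forall i, X (t i) w <= x i / n.+1%:R]); last first.
  by apply/seteqP; split => w /= H i; have := H i; rewrite ler_pdivlMr// mulrC.
have [x0|/existsNP[i /negP]] := pselect (forall i, 0 < x i); first exact: ms.
rewrite -leNgt => xi.
have P0 (y : 'I_k -> R) : y i <= 0 ->
    P [set w | forall i, (X (t i) w <= y i)%R] = 0%E.
  move=> yi; apply/eqP; rewrite -measure_le0 -(frechet_le0 (t i) yi).
  apply: le_measure; rewrite ?inE//; first exact: measurable_box.
  by move=> w /=; apply.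
rewrite big_ord_recl !P0// ?mul0e//.
by rewrite mulr_le0_ge0// invr_ge0.
Qed.

End positive_levels.

Section superposition.
Context {R : realType} {T : choiceType} {d} {Omega : measurableType d}.
Variables (P : probability Omega R) (X : T -> {RV P >-> R}).
Variables (nu : {sigma_finite_measure set R -> \bar R}) (kappa : R).
Hypothesis kappa0 : 0 < kappa.
Hypothesis nu_pos : nu (~` `]0, +oo[) = 0%E.
Variable theta : {fset T} -> R.
Hypothesis theta_ecf : ecf_of X theta.
Hypothesis X_max_stable : simple_max_stable X.
Variable J : R -> R.
Hypothesis JE : forall r, 0 <= r ->
  (\int[nu]_(l in `]0%R, +oo[) (1 - expR (- (l * r)))%:E)%E = (J r)%:E.
Variable beta : R.
Hypothesis beta0 : 0 <= beta.
Hypothesis beta1 : beta + J 1 / kappa = 1.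

Local Notation E := ((R * Omega) * measurableTypeR R)%type.
Local Notation L := (spectral_measure P nu).

Context {d'} {W : measurableType d'} (Pi : probability W R).
Variables (on : nat -> nat -> set W) (pt : nat -> nat -> W -> E).
Hypothesis measurable_on : forall m i, measurable (on m i).
Hypothesis measurable_pt : forall m i, measurable_fun setT (pt m i).
Hypothesis void : forall B : set E, measurable B -> (L B < +oo)%E ->
  Pi [set w | forall m i, on m i w -> ~ B (pt m i w)] =
  (expR (- fine (L B)))%:E.

Let theta_ge0 A : 0 <= theta A. Proof. by have [] := theta_ecf. Qed.

Let cdfX A y : 0 < y -> P (cdf_fset X A y) = (expR (- (theta A / y)))%:E.
Proof. exact: ecf_of_cdf. Qed.

(** Forced by the unit Frechet margins of [X]; together with [beta1] it normalizes the margins of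
    the superposition. *)
Let theta1 t : theta [fset t]%fset = 1.
Proof.
have := cdfX [fset t]%fset ltr01.
rewrite (_ : cdf_fset _ _ _ = [set w | X t w <= 1]); last first.
  by apply/seteqP; split => w /= H; [apply: H; rewrite inE|move=> s; rewrite inE => /eqP->].
rewrite X_max_stable.1// => -[/expR_inj/oppr_inj].
by rewrite !divr1.
Qed.

(** An absent point gets height 0, which never exceeds a nonnegative level. *)
Let height m i t w := \1_(on m i) w * spectral X kappa t (pt m i w).

(* Almost surely finite; the null event where it is infinite is absorbed by the
   value [fine +oo = 0]. *)
Definition sup_height t w : \bar R :=
  ereal_sup (range (fun mi : nat * nat => (height mi.1 mi.2 t w)%:E)).

Let measurable_height m i t : measurable_fun setT (height m i t).
Proof.
apply: measurable_funM; first exact: measurable_indic.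
apply: measurableT_comp; last exact: measurable_pt.
exact: measurable_spectral.
Qed.

Let measurable_sup_height t : measurable_fun setT (sup_height t).
Proof.
apply: (measurability _ (ErealGenOInfty.measurableE R)) => // _ [_ [y ->] <-].
rewrite setTI (_ : _ @^-1` _ =
    \bigcup_m \bigcup_i [set w | (y%:E < (height m i t w)%:E)%E]).
  apply: bigcupT_measurable => m; apply: bigcupT_measurable => i.
  rewrite -[X in measurable X]setTI; apply: emeasurable_fun_o_infty => //.
  exact/measurable_EFinP.
apply/seteqP; split => w; rewrite /= in_itv/= andbT.
  by move=> /ereal_sup_gt[_ [[m i] _ <-] yh]; exists m => //; exists i.
move=> [m _ [i _ yh]]; apply: (lt_le_trans yh).
by apply: ereal_sup_ubound; exists (m, i).
Qed.

Let height_ge0 m i t w : 0 <= height m i t w.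
Proof. by rewrite mulr_ge0// spectral_ge0. Qed.

Let sup_height_ge0 t w : (0 <= sup_height t w)%E.
Proof.
apply: le_trans (ereal_sup_ubound _); last by exists (0%N, 0%N).
by rewrite lee_fin.
Qed.

Let sup_height_leP t w y : 0 <= y -> (sup_height t w <= y%:E)%E <->
  forall m i, on m i w -> spectral X kappa t (pt m i w) <= y.
Proof.
move=> y0; split => [Sy m i onw|H].
  rewrite -lee_fin; apply: le_trans Sy; apply: ereal_sup_ubound.
  by exists (m, i) => //=; rewrite /height indicE mem_set// mul1r.
apply: ge_ereal_sup => _ [[m i] _ <-]; rewrite lee_fin /height indicE.
case: (boolP (w \in on m i)); last by rewrite mul0r.
by rewrite inE mul1r => /H.
Qed.

Let hit_cst k (t : 'I_k -> T) y : 0 < y ->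
  L (hit X kappa t (fun=> y)) =
  (J (theta [fset t i | i in 'I_k]%fset) / (kappa * y))%:E.
Proof.
move=> y0; rewrite (spectral_measure_hit_cst kappa0 nu_pos cdfX)// JE//.
by rewrite -EFinM mulrC.
Qed.

(** Lowering all levels to a common positive one enlarges the hit set, whose measure is then given
    by [hit_cst]. *)
Let hit_fin k (t : 'I_k -> T) x : (forall i, 0 < x i) -> (L (hit X kappa t x) < +oo)%E.
Proof.
(* The default 1 provides a positive level also when [k = 0]. *)
move=> x0; pose y := \big[Num.min/1]_i x i.
have y0 : 0 < y by rewrite /y; elim/big_ind : _ => // a b a0 b0; rewrite lt_min a0.
apply: (@le_lt_trans _ _ (L (hit X kappa t (fun=> y)))); last first.
  by rewrite hit_cst// ltry.
apply: le_measure; rewrite ?inE; try exact: measurable_hit.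
by move=> p [i xi]; exists i; apply: le_lt_trans xi; exact: bigmin_le_cond.
Qed.

(** The suprema respect the levels exactly when no point of the Poisson process lies in the hit set,
    so this is a void probability. *)
Let sup_height_fdd k (t : 'I_k -> T) x : (forall i, 0 < x i) ->
  Pi [set w | forall i, (sup_height (t i) w <= (x i)%:E)%E] =
  (expR (- fine (L (hit X kappa t x))))%:E.
Proof.
move=> x0; rewrite -void; [|exact: measurable_hit|exact: hit_fin].
congr (Pi _); apply/seteqP; split => w /=.
  move=> H m i onw [j]; apply/negP; rewrite -leNgt.
  by move/sup_height_leP : (H j); apply => //; exact/ltW.
move=> H i; apply/sup_height_leP; first exact/ltW.
by move=> m j onw; rewrite leNgt; apply/negP => xi; apply: (H m j onw); exists i.
Qed.

Let sup_height_infty s : Pi.-negligible [set w | sup_height s w = +oo%E].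
Proof.
have mS : measurable [set w | sup_height s w = +oo%E].
  rewrite -[X in measurable X]setTI.
  exact: (measurable_sup_height s measurableT (emeasurable_set1 +oo%E)).
apply/negligibleP => //; apply/eqP; rewrite eq_le measure_ge0 andbT.
pose c := J (theta [fset s | i in 'I_1]%fset) / kappa.
have c1 : 0 < `|c| + 1 by rewrite ltr_wpDl.
apply/lee_addgt0Pr => e e0; rewrite add0e.
(* Chosen so that [c / y <= e], whence [1 - exp (- c / y) <= e]; the absolute value and the 1 make
   [y] positive. *)
pose y := (`|c| + 1) / e; have y0 : 0 < y by rewrite divr_gt0.
pose D := [set w | forall i : 'I_1, (sup_height s w <= y%:E)%E].
have PD : Pi D = (expR (- (c / y)))%:E.
  rewrite /D (@sup_height_fdd 1 (fun=> s) (fun=> y))// hit_cst//=.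
  by rewrite /c invfM mulrA.
have mD : measurable D.
  rewrite (_ : D = sup_height s @^-1` `]-oo, y%:E]).
    rewrite -[Y in measurable Y]setTI.
    by apply: measurable_sup_height => //; exact: emeasurable_itv.
  apply/seteqP; split => w; rewrite /D/= in_itv//=.
  by move=> /(_ ord0).
apply: (@le_trans _ _ (Pi (~` D))).
  apply: le_measure; rewrite ?inE//; first exact: measurableC.
  by move=> w /= Sw /(_ ord0); rewrite Sw leye_eq.
rewrite probability_setC// PD lee_fin lerBlDr -lerBlDl.
have := expR_ge1Dx (- (c / y)); apply: le_trans; rewrite lerD2l lerN2.
rewrite /y invf_div mulrA ler_pdivrMr// mulrC ler_pM2l//.
by rewrite (le_trans (ler_norm _))// lerDl.
Qed.

(** Applying [fine] alters the event only where one of finitely many suprema is infinite, a null set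
    by [sup_height_infty]. *)
Let fine_sup_height_fdd k (t : 'I_k -> T) x : (forall i, 0 < x i) ->
  Pi [set w | forall i, fine (sup_height (t i) w) <= x i] =
  (expR (- fine (L (hit X kappa t x))))%:E.
Proof.
move=> x0; rewrite -(@sup_height_fdd k t x x0).
set D := [set _ | _]; set D' := [set _ | _].
have mD : measurable D.
  by apply: measurable_box => i; exact: measurableT_comp.
have mD' : measurable D'.
  rewrite (_ : D' = \bigcap_(i in [set: 'I_k]) (sup_height (t i) @^-1` `]-oo, (x i)%:E])).
    apply: fin_bigcap_measurable; first exact: finite_finset.
    move=> i _; rewrite -[Y in measurable Y]setTI.
    by apply: measurable_sup_height => //; exact: emeasurable_itv.
  apply/seteqP; split => w /= H i; last by have := H i I; rewrite /= in_itv.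
  by move=> _; rewrite /= in_itv/=; exact: H.
have D'D : D' `<=` D.
  move=> w H i; have := H i; have := sup_height_ge0 (t i) w.
  by case: (sup_height _ _) => //= r _; rewrite lee_fin.
have : Pi (D `\` D') = 0%E.
  apply: measure_negligible; first exact: measurableD.
  pose N n := if insub n is Some i then [set w | sup_height (t i) w = +oo%E] else set0.
  apply: (@negligibleS _ _ _ _ (\bigcup_n N n)); last first.
    apply: negligible_bigcup => n; rewrite /N; case: insubP => [i _ _|_].
      exact: sup_height_infty.
    exact: negligible_set0.
  move=> w [Dw /existsNP[i /negP]]; rewrite -ltNge => xS.
  exists (val i) => //; rewrite /N valK /=.
  move: xS (Dw i) (sup_height_ge0 (t i) w).
  case: (sup_height _ _) => //= r; rewrite lte_fin => xr rx.
  by move: (lt_le_trans xr rx); rewrite ltxx.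
move=> DD'0; transitivity (Pi D' + Pi (D `\` D'))%E; last by rewrite DD'0 adde0.
rewrite -measureU//; first by rewrite setDUK.
- exact: measurableD.
- by apply/seteqP; split => // w [? []].
Qed.

Let measurable_fine_sup t : measurable_fun setT (fun w => fine (sup_height t w)).
Proof. exact: measurableT_comp. Qed.

Let measurable_superpos t : measurable_fun [set: W * Omega]
  (fun p => Num.max (beta * X t p.2) (fine (sup_height t p.1))).
Proof.
apply: measurable_maxr.
  by apply: measurable_funM => //; exact: measurableT_comp.
exact: measurableT_comp (measurable_fine_sup t) measurable_fst.
Qed.

Let Q : probability (W * Omega)%type R := (Pi \x P)%E.

Let superpos t : {RV Q >-> R} := HB.pack
  (fun p => Num.max (beta * X t p.2) (fine (sup_height t p.1)))
  (isMeasurableFun.Build _ _ _ _ _ (measurable_superpos t)).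

(** The two terms of the maximum depend on different factors of [Pi \x P], hence are independent. *)
Lemma superpos_fdd k (t : 'I_k -> T) x : (forall i, 0 < x i) ->
  Q [set p | forall i, superpos (t i) p <= x i] =
  ((expR (- fine (L (hit X kappa t x))))%:E *
   P [set w | forall i, (beta * X (t i) w <= x i)%R])%E.
Proof.
move=> x0; rewrite -fine_sup_height_fdd//.
rewrite -product_measure1E//; last 2 first.
- by apply: measurable_box => i; exact: measurable_fine_sup.
- by apply: measurable_box => i; exact: measurable_funM.
congr (Q _); apply/seteqP; split => -[w w'] /=.
  by move=> H; split=> i; have := H i; rewrite ge_max => /andP[].
by move=> [H H'] i; rewrite ge_max H H'.
Qed.

Let scaled_cdf k (t : 'I_k -> T) y : 0 < y ->
  P [set w | forall i, beta * X (t i) w <= y] =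
  (expR (- (beta * theta [fset t i | i in 'I_k]%fset / y)))%:E.
Proof.
(* Levels cannot be divided by [beta = 0], but then the event is sure because [y > 0]. *)
move=> y0; have [b0|] := eqVneq beta 0.
  rewrite b0 !mul0r oppr0 expR0 (_ : [set _ | _] = setT) ?probability_setT//.
  by apply/seteqP; split => // w _ i; rewrite /= mul0r ltW.
move=> bN0; have b0 : 0 < beta by rewrite lt_def bN0.
transitivity (P (cdf_fset X [fset t i | i in 'I_k]%fset (y / beta))).
  congr (P _); rewrite cdf_fsetE; apply/seteqP; split => w /= H i; have := H i;
    by rewrite ler_pdivlMr// mulrC.
by rewrite cdfX ?divr_gt0// invf_div mulrA (mulrC beta).
Qed.

Let superpos_cst k (t : 'I_k -> T) y : 0 < y ->
  Q [set p | forall i, superpos (t i) p <= y] =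
  (expR (- ((beta * theta [fset t i | i in 'I_k]%fset +
             J (theta [fset t i | i in 'I_k]%fset) / kappa) / y)))%:E.
Proof.
move=> y0; rewrite (superpos_fdd t (x := fun=> y))// hit_cst// scaled_cdf//=.
rewrite -EFinM -expRD; congr (expR _)%:E.
by rewrite mulrDl opprD invfM mulrA addrC.
Qed.

Lemma superpos_frechet t y : 0 < y ->
  Q [set p | superpos t p <= y] = (expR (- (1 / y)))%:E.
Proof.
move=> y0; have := @superpos_cst 1 (fun=> t) y y0.
rewrite (_ : [fset t | i in 'I_1]%fset = [fset t]%fset); last first.
  apply/fsetP => s; rewrite inE; apply/imfsetP/eqP => [[i _ ->]//|->].
  by exists ord0.
rewrite theta1 mulr1 beta1 => <-; congr (Q _).
by apply/seteqP; split => p /= => [H i|/(_ ord0)].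
Qed.

Let scaled_max_stable n k (t : 'I_k -> T) (x : 'I_k -> R) : (forall i, 0 < x i) ->
  (\prod_(j < n.+1) P [set w | forall i, (beta * X (t i) w <= x i)%R])%E =
  P [set w | forall i, beta * X (t i) w <= x i / n.+1%:R].
Proof.
move=> x0; have [b0|] := eqVneq beta 0.
  have E0 (y : 'I_k -> R) : (forall i, 0 < y i) ->
      P [set w | forall i, beta * X (t i) w <= y i] = 1%E.
    move=> y0; rewrite (_ : [set _ | _] = setT) ?probability_setT//.
    by apply/seteqP; split => // w _ i; rewrite /= b0 mul0r ltW.
  by rewrite !E0// ?big1// => i; rewrite divr_gt0.
move=> bN0; have b0 : 0 < beta by rewrite lt_def bN0.
have BE (y : 'I_k -> R) : [set w | forall i, beta * X (t i) w <= y i] =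
    [set w | forall i, X (t i) w <= y i / beta].
  by apply/seteqP; split => w /= H i; have := H i; rewrite ler_pdivlMr// mulrC.
have nE i w : (n.+1%:R * X (t i) w <= x i / beta) =
    (X (t i) w <= x i / n.+1%:R / beta).
  by rewrite (mulrAC (x i)) [RHS]ler_pdivlMr// mulrC.
rewrite BE (simple_max_stable_cdf X_max_stable) BE; congr (P _).
by apply/seteqP; split => w /= H i; have := H i; rewrite nE.
Qed.

(** Dividing the levels by [n.+1] raises both factors of [superpos_fdd] to the power [n.+1]: one by
    the scaling of the spectral measure, the other by the max-stability of [X]. *)
Lemma superpos_max_stable : simple_max_stable superpos.
Proof.
apply: simple_max_stableI; first exact: superpos_frechet.
apply: max_stable_cdf_pos; first exact: superpos_frechet.
move=> n k t x x0.
have xn0 i : 0 < x i / n.+1%:R by rewrite divr_gt0.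
rewrite superpos_fdd// (superpos_fdd t xn0) -scaled_max_stable//.
rewrite spectral_measure_hit_scale// big_split /=; congr *%E.
rewrite prodEFin prodr_const card_ord; congr EFin.
rewrite -expRM_natl -mulr_natl mulrN fineM//.
by rewrite ge0_fin_numE ?hit_fin.
Qed.

Lemma superpos_ecf :
  ecf_of superpos (fun A => beta * theta A + J (theta A) / kappa).
Proof.
have th0 : theta fset0 = 0 by have [] := theta_ecf.
have J0 r : 0 <= r -> 0 <= J r.
  move=> r0; rewrite -lee_fin -JE//; apply: integral_ge0 => l.
  rewrite /= in_itv/= andbT => l0; rewrite lee_fin subr_ge0 -expR0 ler_expR.
  by rewrite oppr_le0 mulr_ge0// ltW.
apply: cdf_ecf_of => [A||A y y0].
- by rewrite addr_ge0// ?mulr_ge0// ?invr_ge0 ?J0// ltW.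
- rewrite th0 mulr0 add0r; suff -> : J 0 = 0 by rewrite mul0r.
  apply: EFin_inj; rewrite -JE// integral0_eq// => l _.
  by rewrite mulr0 oppr0 expR0 subrr.
(* The distribution formulas concern families indexed by ordinals, so [A] is enumerated. *)
pose t (i : 'I_#|{: A}|) : T := val (enum_val i).
have tA : [fset t i | i in 'I_#|{: A}|]%fset = A.
  apply/fsetP => s; apply/imfsetP/idP => [[i _ ->]|sA]; first exact: valP.
  by exists (enum_rank [` sA]%fset) => //; rewrite /t enum_rankK.
have := superpos_cst t y0; rewrite tA => <-; congr (Q _).
by rewrite -{1}tA cdf_fsetE.
Qed.

Lemma superpos_is_ecf : is_ecf (fun A => beta * theta A + J (theta A) / kappa).
Proof.
exists _, _, Q, superpos; split.
  exact: superpos_max_stable.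
exact: superpos_ecf.
Qed.

End superposition.

(** * From the Bernstein representation to the superposition *)

Section bernstein.
Context {R : realType} (g : R -> R) (c b : R) (nu : {measure set R -> \bar R}).
Hypothesis b0 : 0 <= b.
Hypothesis radon : forall K : set R,
  compact K -> K `<=` `]0, +oo[ -> (nu K < +oo)%E.
Hypothesis gE : forall r, 0 <= r -> (g r)%:E =
  ((c + b * r)%:E +
   \int[nu]_(l in `]0%R, +oo[) (1 - expR (- (l * r)))%:E)%E.

Let mD : measurable (`]0, +oo[%classic : set R). Proof. exact: measurable_itv. Qed.

(** The integral part of [g], defined as a difference so that it is a real number from the start. *)
Let J r := g r - (c + b * r).

Let JE r : 0 <= r ->
  (\int[nu]_(l in `]0%R, +oo[) (1 - expR (- (l * r)))%:E)%E = (J r)%:E.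
Proof. by move=> r0; rewrite EFinB gE// addeAC subee// add0e. Qed.

Let J0 : J 0 = 0.
Proof.
apply: EFin_inj; rewrite -JE// integral0_eq// => l _.
by rewrite mulr0 oppr0 expR0 subrr.
Qed.

Lemma bernstein0 : g 0 = c.
Proof. by apply/eqP; rewrite -subr_eq0; have := J0; rewrite /J mulr0 addr0 => ->. Qed.

Let one_sub_expR_ge0 r l : 0 <= r -> (`]0, +oo[%classic : set R) l ->
  0 <= 1 - expR (- (l * r)).
Proof.
rewrite /= in_itv/= andbT => r0 l0; rewrite subr_ge0 -expR0 ler_expR.
by rewrite oppr_le0 mulr_ge0// ltW.
Qed.

Let measurable_one_sub_expR r :
  measurable_fun (`]0, +oo[%classic : set R) (fun l : R => (1 - expR (- (l * r)))%:E).
Proof.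
apply/measurable_EFinP/measurable_funTS/measurable_funB => //.
apply: measurableT_comp => //; apply: measurableT_comp => //.
exact: measurable_funM.
Qed.

(** If [g 1 = g 0], then [b] and the integral of [1 - exp (- l)] are zero. This integrand is
    positive on []0, +oo[], so [nu] vanishes there and [g] is the constant [c]. *)
Lemma bernstein_slope : ~ (exists k : R, forall r : R, 0 <= r -> g r = k) ->
  0 < g 1 - g 0.
Proof.
move=> ncst; have J1 : 0 <= J 1.
  rewrite -lee_fin -JE//; apply: integral_ge0 => l Dl.
  by rewrite lee_fin one_sub_expR_ge0.
have E1 : g 1 - g 0 = b + J 1 by rewrite bernstein0 /J mulr1; ring.
rewrite lt_def E1 addr_ge0// andbT; apply/negP => /eqP bJ.
have bz : b = 0 by apply/eqP; rewrite eq_le b0 andbT -bJ lerDl.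
have J1z : J 1 = 0 by rewrite -bJ bz add0r.
apply: ncst; exists c => r r0.
apply: EFin_inj; rewrite gE// bz mul0r addr0.
have := JE ler01; rewrite J1z => I0.
have nuD : nu `]0, +oo[%classic = 0%E.
  have : ae_eq nu (`]0, +oo[%classic : set R) (fun l : R => (1 - expR (- (l * 1)))%:E) (cst 0%E).
    apply/ae_eq_integral_abs => //; rewrite -[RHS]I0.
    apply: eq_integral => l; rewrite inE => Dl.
    by rewrite gee0_abs// lee_fin one_sub_expR_ge0.
  move=> f0; apply: measure_negligible => //; apply: negligibleS f0.
  move=> l Dl /= fl0; have : 1 - expR (- (l * 1)) = 0 by apply: EFin_inj; exact: fl0.
  move/eqP; apply/negP; rewrite gt_eqF// subr_gt0.
  rewrite mulr1 -expR0 ltr_expR oppr_lt0.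
  by move: Dl; rewrite /= in_itv/= andbT.
by rewrite null_set_integral// adde0.
Qed.

(** Outside []0, +oo[] nothing is known about [nu]; the restriction is null there and sigma-finite,
    as the product construction requires. *)
Definition restricted_measure : set R -> \bar R := mrestr nu mD.

HB.instance Definition _ := Measure.on restricted_measure.

(** The compact intervals [[1 / (n + 1), n + 1]] have finite mass by the Radon property; the
    complement of []0, +oo[] is adjoined at no cost to exhaust the line. *)
Let restricted_sigma_finite : sigma_finite setT restricted_measure.
Proof.
exists (fun n => `[n.+1%:R^-1, n.+1%:R]%classic `|` ~` `]0, +oo[%classic).
  apply/seteqP; split => // x _ /=; have [x0|x0] := ltP 0 x; last first.
    by exists 0%N => //; right; rewrite /= in_itv/= andbT ltNge x0.
  have xV0 : 0 < x^-1 by rewrite invr_gt0.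
  exists (maxn (Num.bound x) (Num.bound x^-1)) => //; left.
  rewrite /= in_itv/=; apply/andP; split.
    rewrite -[leRHS]invrK lef_pV2 ?posrE//.
    apply: (le_trans (ltW (archi_boundP (ltW xV0)))).
    by rewrite ler_nat (leq_trans (leq_maxr _ _) (leqnSn _)).
  apply: (le_trans (ltW (archi_boundP (ltW x0)))).
  by rewrite ler_nat (leq_trans (leq_maxl _ _) (leqnSn _)).
move=> n; split; first by apply: measurableU; [exact: measurable_itv|exact: measurableC].
apply: (@le_lt_trans _ _ (nu `[n.+1%:R^-1, n.+1%:R]%classic)).
  rewrite /restricted_measure /mrestr; apply: le_measure; rewrite ?inE//.
    by apply: measurableI => //; apply: measurableU; [exact: measurable_itv|exact: measurableC].
  by move=> x [[]].
apply: radon; first exact: segment_compact.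
move=> x; rewrite /= !in_itv/= andbT => /andP[nx _].
by apply: lt_le_trans nx; rewrite invr_gt0.
Qed.

HB.instance Definition _ := Measure_isSigmaFinite.Build _ _ _ restricted_measure
  restricted_sigma_finite.

Lemma bernstein_ecf (T : choiceType) (theta : {fset T} -> R) :
  is_ecf theta -> 0 < g 1 - g 0 ->
  is_ecf (fun A : {fset T} => (g (theta A) - g 0) / (g 1 - g 0)).
Proof.
move=> [d [U [P [X [X_ms X_ecf]]]]] k0.
set kappa := g 1 - g 0 in k0 *.
(* Since [g 0 = c], the constant cancels, and the linear term yields the weight [b / kappa] of [X]
   in the superposition. *)
rewrite (_ : (fun A => _) = fun A => b / kappa * theta A + J (theta A) / kappa); last first.
  by apply/funext => A; rewrite bernstein0 /J mulrAC -mulrDl; congr (_ / _); ring.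
have [d' [W [Pi [active [pt [mon mpt void]]]]]] :=
  poisson_void (spectral_measure P restricted_measure).
apply: (superpos_is_ecf k0 _ X_ecf X_ms _ _ _ mon mpt void).
- transitivity (nu (~` `]0, +oo[%classic `&` `]0, +oo[%classic)); first by [].
  by rewrite setICl measure0.
- move=> r r0; rewrite -JE//; apply: eq_measure_integral => A mA AD.
  transitivity (nu (A `&` `]0, +oo[%classic)); first by [].
  by rewrite setIidl.
- by rewrite divr_ge0// ltW.
- rewrite -mulrDl (_ : b + J 1 = kappa) ?mulfV ?gt_eqF//.
  by rewrite /kappa /J bernstein0 mulr1; ring.
Qed.

End bernstein.

Theorem corollary20 (R : realType) (T : choiceType) (theta : {fset T} -> R)
    (g : R -> R)
    (theta_ecf : is_ecf theta)
    (g_bernstein : bernstein g)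
    (g_nonconstant : ~ exists k : R, forall r : R, 0 <= r -> g r = k) :
  is_ecf (fun A : {fset T} => (g (theta A) - g 0) / (g 1 - g 0)).
Proof.
have [_ [c [b [nu [_ b0 radon _ gE]]]]] := g_bernstein.
apply: (bernstein_ecf b0 radon gE theta_ecf).
exact: bernstein_slope b0 gE g_nonconstant.
Qed.
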